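(* Let $n\ge 2$ be a fixed integer. For each integer $k\ge 1$ let $C_k\subset\mathbb{P}^k_{\mathbb{C}}$ be the image of $\mathbb{P}^1_{\mathbb{C}}$ under the Veronese embedding of degree $k$, and let $X_{k,n}=\phi(C_k\times\mathbb{P}^{n-1}_{\mathbb{C}})$, where $\phi$ is the Segre embedding of $\mathbb{P}^k_{\mathbb{C}}\times\mathbb{P}^{n-1}_{\mathbb{C}}$. Then the projective varieties $X_{k,n}$, $k=1,2,\dots$, have pairwise different degrees, and among the affine cones $C_{\mathbb{C}}(X_{k,n})$, $k=1,2,\dots$, there are infinitely many that are pairwise bi-Lipschitz and semi-algebraically equivalent.
   Context: The Veronese embedding of degree $k$ is $\mathbb{P}^1_{\mathbb{C}}\to\mathbb{P}^k_{\mathbb{C}}$, $[z_0:z_1]\mapsto[z_0^k:z_0^{k-1}z_1:\dots:z_0z_1^{k-1}:z_1^k]$. The Segre embedding is $\phi:\mathbb{P}^k_{\mathbb{C}}\times\mathbb{P}^{n-1}_{\mathbb{C}}\to\mathbb{P}^{n_k}_{\mathbb{C}}$ with $n_k=(k+1)n-1$, $([z_0:\dots:z_k],[w_0:\dots:w_{n-1}])\mapsto[z_iw_j]_{i,j}$. For a projective variety $X\subset\mathbb{P}^N_{\mathbb{C}}$, the affine cone $C_{\mathbb{C}}(X)\subset\mathbb{C}^{N+1}$ is the affine variety defined by the same homogeneous equations as $X$. A map between subsets of Euclidean spaces is bi-Lipschitz if it is a homeomorphism, it is Lipschitz and its inverse is Lipschitz (for the Euclidean distances of the ambient spaces). Two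 sets $A\subset\mathbb{C}^p\cong\mathbb{R}^{2p}$ and $B\subset\mathbb{C}^q\cong\mathbb{R}^{2q}$ are called bi-Lipschitz and semi-algebraically equivalent if there is a bi-Lipschitz homeomorphism $A\to B$ which is semi-algebraic. *)

(* Defs.v *)
From HB Require Import structures.
From mathcomp Require Import all_boot all_order all_algebra.
From mathcomp Require Import boolp classical_sets functions cardinality reals.
From mathcomp Require Import complex mpoly.

Set Implicit Arguments.
Unset Strict Implicit.
Unset Printing Implicit Defensive.

Import Order.TTheory GRing.Theory Num.Theory.
Local Open Scope classical_set_scope.
Local Open Scope card_scope.
Local Open Scope ring_scope.

(* [proj F N] is the projective space of lines of F^N, i.e. P^(N-1) over F:
   the index is the number of homogeneous coordinates.                       *)
Definition proj (F : fieldType) (N : nat) :=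
  {V : {vspace 'rV[F]_N} | \dim V == 1%N}.

Lemma dim_line (F : fieldType) (N : nat) (v : 'rV[F]_N) :
  v != 0 -> \dim <[v]> == 1%N.
Proof. by rewrite dim_vline => ->. Qed.

Definition proj_pt (F : fieldType) (N : nat) (v : 'rV[F]_N) (v0 : v != 0) :
  proj F N := exist _ <[v]>%VS (dim_line v0).

Definition proj_rep (F : fieldType) (N : nat) (p : proj F N) : 'rV[F]_N :=
  vpick (val p).

Lemma proj_rep_neq0 (F : fieldType) (N : nat) (p : proj F N) :
  proj_rep p != 0.
Proof.
by rewrite vpick0 -dimv_eq0; case: p => V /= /eqP ->.
Qed.

Lemma proj_repP (F : fieldType) (N : nat) (v : 'rV[F]_N) (v0 : v != 0) :
  exists2 c : F, c != 0 & proj_rep (proj_pt v0) = c *: v.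
Proof.
have /vlineP[c E] : proj_rep (proj_pt v0) \in <[v]>%VS by exact: memv_pick.
exists c => //; apply: contra_neq (proj_rep_neq0 (proj_pt v0)) => c0.
by rewrite E c0 scale0r.
Qed.

Lemma proj_pt_eq (F : fieldType) (N : nat) (v w : 'rV[F]_N) (c : F)
    (v0 : v != 0) (w0 : w != 0) :
  c != 0 -> v = c *: w -> proj_pt v0 = proj_pt w0.
Proof.
move=> c0 E; apply: val_inj => /=; apply/eqP.
rewrite eqEdim !dim_vline v0 w0 leqnn andbT -memvE E.
by rewrite memvZ ?memv_line.
Qed.

Definition veronese_vec (F : fieldType) (k : nat) (z : 'rV[F]_2) :
  'rV[F]_k.+1 :=
  \row_(i < k.+1) (z 0 0 ^+ (k - i) * z 0 1 ^+ i).

Lemma veronese_vec_neq0 (F : fieldType) (k : nat) (z : 'rV[F]_2) :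
  z != 0 -> veronese_vec k z != 0.
Proof.
apply: contra_neq => /rowP E; apply/rowP => i; rewrite mxE.
have := E ord0; rewrite !mxE subn0 expr0 mulr1 => /eqP.
rewrite expf_eq0 => /andP[_ /eqP z0].
have := E ord_max; rewrite !mxE subnn expr0 mul1r => /eqP.
rewrite expf_eq0 => /andP[_ /eqP z1].
case: i => [[|[|//]] ltj].
  by rewrite -z0; congr (z _ _); apply: val_inj.
by rewrite -z1; congr (z _ _); apply: val_inj.
Qed.

Definition veronese (F : fieldType) (k : nat) (p : proj F 2) : proj F k.+1 :=
  proj_pt (veronese_vec_neq0 k (proj_rep_neq0 p)).

Lemma veroneseE (F : fieldType) (k : nat) (z : 'rV[F]_2) (z0 : z != 0) :
  veronese k (proj_pt z0) = proj_pt (veronese_vec_neq0 k z0).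
Proof.
have [c c0 E] := proj_repP z0.
apply: (proj_pt_eq _ _ (expf_neq0 k c0)).
apply/rowP => i; rewrite E !mxE !exprMn mulrACA -exprD subnK //.
by rewrite -ltnS.
Qed.

(* Homogeneous coordinates on the target of the Segre embedding are indexed by
   the pairs (i, j), flattened by [mxvec].                                   *)
Definition segre_vec (F : fieldType) (M N : nat)
    (z : 'rV[F]_M) (w : 'rV[F]_N) : 'rV[F]_(M * N) :=
  mxvec (\matrix_(i < M, j < N) (z 0 i * w 0 j)).

Lemma segre_vec_neq0 (F : fieldType) (M N : nat)
    (z : 'rV[F]_M) (w : 'rV[F]_N) :
  z != 0 -> w != 0 -> segre_vec z w != 0.
Proof.
move=> /rV0Pn[i zi] /rV0Pn[j wj]; rewrite mxvec_eq0.
apply/eqP => /matrixP /(_ i j); rewrite !mxE => /eqP.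
by rewrite mulf_eq0 (negPf zi) (negPf wj).
Qed.

Definition segre (F : fieldType) (M N : nat) (p : proj F M) (q : proj F N) :
  proj F (M * N) :=
  proj_pt (segre_vec_neq0 (proj_rep_neq0 p) (proj_rep_neq0 q)).

Lemma segreE (F : fieldType) (M N : nat) (z : 'rV[F]_M) (w : 'rV[F]_N)
    (z0 : z != 0) (w0 : w != 0) :
  segre (proj_pt z0) (proj_pt w0) = proj_pt (segre_vec_neq0 z0 w0).
Proof.
have [a a0 Ea] := proj_repP z0; have [b b0 Eb] := proj_repP w0.
apply: (proj_pt_eq _ _ (mulf_neq0 a0 b0)).
rewrite /segre_vec -linearZ; congr mxvec.
by apply/matrixP => i j; rewrite Ea Eb !mxE mulrACA.
Qed.

Definition rational_normal_curve (F : fieldType) (k : nat) :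
  set (proj F k.+1) := range (@veronese F k).
Arguments rational_normal_curve F k : clear implicits.

Definition Xkn (F : fieldType) (k n : nat) : set (proj F (k.+1 * n)) :=
  [set segre p q | p in rational_normal_curve F k & q in [set: proj F n]].
Arguments Xkn F k n : clear implicits.

(* The linear subspace cut out by the r linear forms which are the columns of
   A; it has codimension r when A has rank r.                                *)
Definition linear_subspace (F : fieldType) (N r : nat) (A : 'M[F]_(N, r)) :
  set (proj F N) :=
  [set p | proj_rep p *m A = 0].

(* The dimension of a projective variety is the least m for which some linear
   subspace of codimension m.+1 misses it, i.e. the largest m for which every
   linear subspace of codimension m meets it.                                *)
Definition has_dim (F : fieldType) (N : nat) (X : set (proj F N)) (m : nat) :
  Prop :=
  (exists A : 'M[F]_(N, m.+1), X `&` linear_subspace A = set0) /\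
  (forall A : 'M[F]_(N, m), X `&` linear_subspace A !=set0).

(* A property holds for a generic matrix if it holds on some nonempty Zariski
   open set of matrices.  Over an infinite field the basic open set where a
   nonzero polynomial g in the entries does not vanish is nonempty.          *)
Definition generically (F : fieldType) (N r : nat) (P : 'M[F]_(N, r) -> Prop) :
  Prop :=
  exists2 g : {mpoly F[N * r]}, g != 0 &
    forall A : 'M[F]_(N, r), g.@[fun i => mxvec A 0 i] != 0 -> P A.

(* The degree of X is the number of points in which X meets a generic linear
   subspace of complementary dimension.                                      *)
Definition has_degree (F : fieldType) (N : nat) (X : set (proj F N)) (d : nat) :
  Prop :=
  exists2 m : nat, has_dim X m &
    generically (fun A : 'M[F]_(N, m) => X `&` linear_subspace A #= `I_d).

Definition affine_cone (F : fieldType) (N : nat) (X : set (proj F N)) :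
  set 'rV[F]_N :=
  [set x : 'rV[F]_N | forall (d : nat) (f : {mpoly F[N]}), f \is d.-homog ->
     (forall p, X p -> f.@[fun i => proj_rep p 0 i] = 0) ->
     f.@[fun i => x 0 i] = 0].

Inductive semialgebraic (R : realType) (N : nat) : set 'rV[R]_N -> Prop :=
| semialgebraic_gt0 (f : {mpoly R[N]}) :
    semialgebraic [set x : 'rV[R]_N | 0 < f.@[fun i => x 0 i]]
| semialgebraicC (A : set 'rV[R]_N) :
    semialgebraic A -> semialgebraic (~` A)
| semialgebraicU (A B : set 'rV[R]_N) :
    semialgebraic A -> semialgebraic B -> semialgebraic (A `|` B)
| semialgebraicI (A B : set 'rV[R]_N) :
    semialgebraic A -> semialgebraic B -> semialgebraic (A `&` B).

(* The identification of C^p with R^(2p). *)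
Definition realify (R : realType) (p : nat) (x : 'rV[R[i]]_p) :
  'rV[R]_(p + p) :=
  row_mx (map_mx (@complex.Re R) x) (map_mx (@complex.Im R) x).

Definition euclid_dist (R : realType) (N : nat) (x y : 'rV[R]_N) : R :=
  Num.sqrt (\sum_(i < N) (x 0 i - y 0 i) ^+ 2).

Definition cdist (R : realType) (p : nat) (x y : 'rV[R[i]]_p) : R :=
  euclid_dist (realify x) (realify y).

Definition lipschitz_in (R : realType) (p q : nat) (A : set 'rV[R[i]]_p)
    (f : 'rV[R[i]]_p -> 'rV[R[i]]_q) : Prop :=
  exists K : R, forall x y, A x -> A y -> cdist (f x) (f y) <= K * cdist x y.

Definition semialgebraic_map (R : realType) (p q : nat) (A : set 'rV[R[i]]_p)
    (f : 'rV[R[i]]_p -> 'rV[R[i]]_q) : Prop :=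
  semialgebraic [set row_mx (realify x) (realify (f x)) | x in A].

(* f and g are mutually inverse Lipschitz, hence continuous, bijections between
   A and B; their values outside A and B are irrelevant.                     *)
Definition bilipschitz_semialgebraic_equiv (R : realType) (p q : nat)
    (A : set 'rV[R[i]]_p) (B : set 'rV[R[i]]_q) : Prop :=
  exists (f : 'rV[R[i]]_p -> 'rV[R[i]]_q) (g : 'rV[R[i]]_q -> 'rV[R[i]]_p),
    [/\ (forall x, A x -> B (f x)), (forall y, B y -> A (g y)),
        (forall x, A x -> g (f x) = x) & (forall y, B y -> f (g y) = y)] /\
    [/\ lipschitz_in A f, lipschitz_in B g & semialgebraic_map A f].

(* Main.v *)
Require Import Defs.
From mathcomp Require Import all_boot all_order all_algebra.
From mathcomp Require Import boolp classical_sets functions cardinality reals.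
From mathcomp Require Import complex mpoly.
From mathcomp Require Import perm separable.
From mathcomp Require Import ordered_qelim qe_rcf.
From mathcomp Require Import zify ring lra.

Set Implicit Arguments.
Unset Strict Implicit.
Unset Printing Implicit Defensive.

Import Order.TTheory GRing.Theory Num.Theory.
Local Open Scope classical_set_scope.
Local Open Scope card_scope.
Local Open Scope ring_scope.

(* Write v_k for the Veronese map. The cone over X_{k,n} consists of the vectors
   v_k(z) (x) w, so away from its vertex it is the complement of the zero section
   in O(-k)^n over P^1. For k even this bundle is trivial as a real bundle: an
   explicit trivialisation T_k is composed from the quaternion matrices with
   entries z0^m, z1^m and from complex conjugations of coordinates. For k, l
   even, v_k(z) (x) w |-> v_l(z) (x) u with |z| = 1 and T_k(z) w = T_l(z) u maps
   one cone onto the other. It is bi-Lipschitz because, in the binomially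
   weighted norm and with the phase of z' chosen so that <z, z'> = t >= 0,
     |v_k(z) (x) w - v_k(z') (x) w'|^2
       = (1 - t^k) (|w|^2 + |w'|^2) + t^k |w - w'|^2,
   and its graph is semi-algebraic by quantifier elimination.

   For the degree, a linear subspace of codimension n meets X_{k,n} where the
   determinant of an n x n matrix of binary forms of degree k vanishes. This
   binary form has degree n k; for a generic subspace it has simple roots, which
   also forces the kernels to be lines, so that there are n k points. *)

(** * Semi-algebraic sets and quantifier elimination *)

(** The parity of k enters through weights. Replacing z by c z with |c| = 1 multiplies w by c^(-k),
    and a trivialisation has to turn this weight into 0 in every coordinate. Conjugating a
    coordinate changes the sign of its weight, and a quaternion matrix with entries z0^m, z1^m
    replaces two weights that differ by 2m by their mean. For k even these two moves bring all n >=
    2 weights from -k to 0. All Lipschitz estimates pass through the quantity |z - z'|^2 (|w|^2 +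
    |w'|^2) + |w - w'|^2, which, once phases are aligned, is comparable to the squared distance in
    the cone for every k >= 1, with constants depending on k. The factor |w|^2 + |w'|^2 makes a
    change of z harmless near the vertex, so the vertex needs no separate argument. *)

Definition polyfun (R : realType) (N : nat) (phi : 'rV[R]_N -> R) : Prop :=
  exists f : {mpoly R[N]}, forall x, phi x = f.@[fun i => x 0 i].

Lemma polyfun_cst (R : realType) (N : nat) (c : R) :
  polyfun (fun _ : 'rV[R]_N => c).
Proof. by exists c%:MP => x; rewrite mevalC. Qed.

Lemma polyfun_coord (R : realType) (N : nat) (i : 'I_N) :
  polyfun (fun x : 'rV[R]_N => x 0 i).
Proof. by exists 'X_i => x; rewrite mevalXU. Qed.

Lemma polyfunD (R : realType) (N : nat) (f g : 'rV[R]_N -> R) :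
  polyfun f -> polyfun g -> polyfun (fun x => f x + g x).
Proof. by move=> [p E] [q E']; exists (p + q) => x; rewrite mevalD E E'. Qed.

Lemma polyfunN (R : realType) (N : nat) (f : 'rV[R]_N -> R) :
  polyfun f -> polyfun (fun x => - f x).
Proof. by move=> [p E]; exists (- p) => x; rewrite mevalN E. Qed.

Lemma polyfunM (R : realType) (N : nat) (f g : 'rV[R]_N -> R) :
  polyfun f -> polyfun g -> polyfun (fun x => f x * g x).
Proof. by move=> [p E] [q E']; exists (p * q) => x; rewrite mevalM E E'. Qed.

Lemma semialgebraic_setT (R : realType) (N : nat) :
  semialgebraic [set: 'rV[R]_N].
Proof.
have -> : [set: 'rV[R]_N] = [set x | 0 < (1 : {mpoly R[N]}).@[fun i => x 0 i]].
  by apply/seteqP; split=> x //= _; rewrite meval1 ltr01.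
exact: semialgebraic_gt0.
Qed.

Lemma semialgebraic_forall (R : realType) (N : nat) (I : finType)
    (A : I -> set 'rV[R]_N) :
  (forall i, semialgebraic (A i)) -> semialgebraic [set x | forall i, A i x].
Proof.
move=> hA.
have E : [set x | forall i, A i x] = \bigcap_(i in [set` enum I]) A i.
  apply/seteqP; split=> x /= Ax i; first by move=> _; exact: Ax.
  by apply: Ax; rewrite /= mem_enum.
rewrite {}E bigcap_seq.
elim/big_ind: _ => [|B C sB sC|i _]; first exact: semialgebraic_setT.
  exact: semialgebraicI.
exact: hA.
Qed.

Lemma semialgebraic_lt (R : realType) (N : nat) (f g : 'rV[R]_N -> R) :
  polyfun f -> polyfun g -> semialgebraic [set x | f x < g x].
Proof.
move=> [p E] [q E'].
have -> : [set x | f x < g x] = [set x | 0 < (q - p).@[fun i => x 0 i]].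
  by apply/funext => x /=; rewrite mevalB E E' subr_gt0.
exact: semialgebraic_gt0.
Qed.

Lemma semialgebraic_eq (R : realType) (N : nat) (f g : 'rV[R]_N -> R) :
  polyfun f -> polyfun g -> semialgebraic [set x | f x = g x].
Proof.
move=> pf pg.
have -> : [set x | f x = g x] = ~` ([set x | f x < g x] `|` [set x | g x < f x]).
  apply/seteqP; split=> x /=.
    by move=> ->; rewrite !ltxx => -[].
  case: (ltgtP (f x) (g x)) => // h nh; case: nh; by [left|right].
by apply: semialgebraicC; apply: semialgebraicU; exact: semialgebraic_lt.
Qed.

(** * Polynomial conditions as first-order formulas *)

Definition row_env (R : realType) (N : nat) (x : 'rV[R]_N) : seq R :=
  [seq x 0 i | i <- enum 'I_N].

Lemma size_row_env (R : realType) (N : nat) (x : 'rV[R]_N) :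
  size (row_env x) = N.
Proof. by rewrite size_map size_enum_ord. Qed.

Lemma nth_row_env (R : realType) (N : nat) (x : 'rV[R]_N) (i : 'I_N) :
  nth 0 (row_env x) i = x 0 i.
Proof. by rewrite (nth_map i) ?size_enum_ord ?nth_ord_enum. Qed.

Lemma polyfun_term (R : realType) (N : nat) (t : GRing.term R) :
  GRing.rterm t -> polyfun (fun x : 'rV[R]_N => GRing.eval (row_env x) t).
Proof.
elim: t => //=.
- move=> i _; have [ltiN|leNi] := ltnP i N.
    have [p E] := polyfun_coord R (Ordinal ltiN).
    by exists p => x; rewrite -E -nth_row_env.
  by exists 0 => x; rewrite meval0 nth_default // size_row_env.
- by move=> c _; exact: polyfun_cst.
- by move=> n _; exact: polyfun_cst.
- by move=> t It u Iu /andP[/It pt /Iu pu]; exact: polyfunD.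
- by move=> t It /It; exact: polyfunN.
- by move=> t It n /It[p E]; exists (p *+ n) => x; rewrite mevalMn E.
- by move=> t It u Iu /andP[/It pt /Iu pu]; exact: polyfunM.
- by move=> t It n /It[p E]; exists (p ^+ n) => x; rewrite rmorphXn /= E.
Qed.

Lemma semialgebraic_qf (R : realType) (N : nat) (f : ord.formula R) :
  ord.qf_form f -> ord.rformula f ->
  semialgebraic [set x : 'rV[R]_N | ord.holds (row_env x) f].
Proof.
elim: f => //=.
- move=> [] _ _.
    have -> : [set _ : 'rV[R]_N | true] = [set: 'rV[R]_N] by apply/seteqP.
    exact: semialgebraic_setT.
  have -> : [set _ : 'rV[R]_N | false] = ~` [set: 'rV[R]_N].
    by rewrite setCT; apply/seteqP; split=> x.
  exact/semialgebraicC/semialgebraic_setT.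
- move=> t u _ /andP[rt ru].
  by apply: semialgebraic_eq; exact: polyfun_term.
- move=> t u _ /andP[rt ru].
  by apply: semialgebraic_lt; exact: polyfun_term.
- move=> t u _ /andP[rt ru].
  have -> : [set x : 'rV[R]_N | GRing.eval (row_env x) t <=
                                GRing.eval (row_env x) u] =
    ~` [set x : 'rV[R]_N | GRing.eval (row_env x) u <
                           GRing.eval (row_env x) t].
    by apply/seteqP; split=> x /=; rewrite leNgt => /negP.
  by apply/semialgebraicC/semialgebraic_lt; exact: polyfun_term.
- move=> f If g Ig /andP[qf qg] /andP[rf rg].
  exact: semialgebraicI (If qf rf) (Ig qg rg).
- move=> f If g Ig /andP[qf qg] /andP[rf rg].
  exact: semialgebraicU (If qf rf) (Ig qg rg).
- move=> f If g Ig /andP[qf qg] /andP[rf rg].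
  have := semialgebraicU (semialgebraicC (If qf rf)) (Ig qg rg).
  congr semialgebraic; apply/seteqP; split=> x /=.
    by case=> [nf /nf|gx _].
  by move=> fg; have [/fg|] := pselect (ord.holds (row_env x) f); [right|left].
- by move=> f If qf rf; exact: semialgebraicC (If qf rf).
Qed.

Definition termfun (R : realType) (N : nat) (phi : 'rV[R]_N -> R) : Prop :=
  exists2 t : GRing.term R, GRing.rterm t &
    forall x, phi x = GRing.eval (row_env x) t.

Lemma termfun_mpoly (R : realType) (N : nat) (p : {mpoly R[N]}) :
  termfun (fun x => p.@[fun i => x 0 i]).
Proof.
have big_termfun I (r : seq I) (F : I -> 'rV[R]_N -> R) :
    (forall i, termfun (F i)) ->
    termfun (fun x => \sum_(i <- r) F i x) /\
    termfun (fun x => \prod_(i <- r) F i x).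
  move=> hF; split; elim: r => [|i r [t rt E]].
  - by exists (GRing.NatConst _ 0) => // x; rewrite big_nil.
  - have [u ru E'] := hF i.
    exists (GRing.Add u t) => [|x] /=; first by rewrite ru rt.
    by rewrite big_cons E E'.
  - by exists (GRing.NatConst _ 1) => // x; rewrite big_nil.
  - have [u ru E'] := hF i.
    exists (GRing.Mul u t) => [|x] /=; first by rewrite ru rt.
    by rewrite big_cons E E'.
rewrite (_ : (fun _ => _) = (fun x : 'rV[R]_N =>
  \sum_(m <- msupp p) p@_m * \prod_(i < N) x 0 i ^+ m i)); last first.
  by apply/funext => x; rewrite mevalE.
refine (big_termfun _ (msupp p)
  (fun m x => p@_m * \prod_(i < N) x 0 i ^+ m i) _).1 => m.
have monf i : termfun (fun x : 'rV[R]_N => x 0 i ^+ m i).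
  exists (GRing.Exp (GRing.Var _ i) (m i)) => // x.
  by rewrite -nth_row_env.
have [t rt E] := (big_termfun _ (index_enum 'I_N) _ monf).2.
exists (GRing.Mul (GRing.Const p@_m) t) => [|x] //=.
by rewrite E.
Qed.

Lemma semialgebraic_formula (R : realType) (N : nat) (A : set 'rV[R]_N) :
  semialgebraic A -> exists2 f : ord.formula R, ord.rformula f &
    forall x, A x <-> ord.holds (row_env x) f.
Proof.
elim=> [p|{}A _ [f rf E]|{}A B _ [f rf E] _ [g rg E']|
        {}A B _ [f rf E] _ [g rg E']].
- have [t rt E] := termfun_mpoly p.
  exists (ord.Lt (GRing.NatConst _ 0) t) => //= x.
  by rewrite E.
- by exists (ord.Not f) => // x; rewrite /= -E.
- by exists (ord.Or f g) => /= [|x]; rewrite ?rf // -E -E'.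
- by exists (ord.And f g) => /= [|x]; rewrite ?rf // -E -E'.
Qed.

(** Variable number [size e] lies one past the end of the environment, so [set_nth] appends its
    value; a block of quantifiers over the variables N, ..., N + M - 1 therefore appends a list of M
    values. *)
Lemma holds_existss (R : realType) (N M : nat) (e : seq R)
    (f : ord.formula R) :
  size e = N ->
  ord.holds e (foldr (fun i g => ord.Exists i g) f (iota N M)) <->
  exists2 s : seq R, size s = M & ord.holds (e ++ s) f.
Proof.
have E e' x : set_nth 0 e' (size e') x = rcons e' x :> seq R.
  elim: e' => //= y e' IH; congr (_ :: _); exact: IH.
elim: M N e => [|M IH] N e <- /=.
  split=> [h|[[|//] _]]; last by rewrite cats0.
  by exists [::] => //; rewrite cats0.
split=> [[x]|[[|x s] //= [hs] h]].
  rewrite E => /(IH _ _ (size_rcons e x))[s hs h].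
  by exists (x :: s) => [/=|]; rewrite ?hs // -cat_rcons.
exists x; rewrite E; apply/(IH _ _ (size_rcons e x)).
by exists s => //; rewrite cat_rcons.
Qed.

Lemma row_env_row_mx (R : realType) (N M : nat) (x : 'rV[R]_N) (y : 'rV[R]_M) :
  row_env (row_mx x y) = row_env x ++ row_env y.
Proof.
apply: (@eq_from_nth _ 0) => [|i].
  by rewrite size_cat !size_row_env.
rewrite size_row_env => hi; rewrite nth_cat size_row_env.
rewrite (nth_row_env (row_mx x y) (Ordinal hi)) mxE.
case: splitP => j /= ->; first by rewrite ltn_ord nth_row_env.
by rewrite ltnNge leq_addr /= addKn nth_row_env.
Qed.

(* Tarski-Seidenberg, by quantifier elimination in real closed fields. *)
Lemma semialgebraic_proj (R : realType) (N M : nat) (E : set 'rV[R]_(N + M)) :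
  semialgebraic E ->
  semialgebraic [set x : 'rV[R]_N | exists y : 'rV[R]_M, E (row_mx x y)].
Proof.
case/semialgebraic_formula => f rf Ef.
pose g := foldr (fun i h => ord.Exists i h) f (iota N M).
have rg : ord.rformula g by rewrite /g; elim: (iota N M).
have /andP[qh rh] :=
  ord.quantifier_elim_wf (@wf_QE_wproj R) rg.
have := semialgebraic_qf N qh rh; congr semialgebraic.
apply/seteqP; split=> x /=.
  move=> /(ord.qf_evalP _ qh).
  move=> /(ord.quantifier_elim_rformP (@wf_QE_wproj R) (@valid_QE_wproj R) _ rg).
  case/(holds_existss _ _ (size_row_env x)) => s hs h.
  exists (\row_i nth 0 s i); apply/Ef; rewrite row_env_row_mx.
  congr (ord.holds (_ ++ _) _): h; apply: (@eq_from_nth _ 0).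
    by rewrite size_row_env.
  move=> i; rewrite hs => hi.
  by rewrite (nth_row_env _ (Ordinal hi)) mxE.
move=> [y /Ef h]; apply/(ord.qf_evalP _ qh).
apply/(ord.quantifier_elim_rformP (@wf_QE_wproj R) (@valid_QE_wproj R) _ rg).
apply/(holds_existss _ _ (size_row_env x)).
by exists (row_env y); rewrite ?size_row_env // -row_env_row_mx.
Qed.

(** * The affine cones *)

(** The points v_k(z) (x) w; projectively they form the rational normal scroll S(k, ..., k). *)
Definition scroll_vec (F : fieldType) (k n : nat) (z : 'rV[F]_2)
    (w : 'rV[F]_n) : 'rV[F]_(k.+1 * n) :=
  segre_vec (veronese_vec k z) w.

Lemma scroll_vecE (F : fieldType) (k n : nat) (z : 'rV[F]_2) (w : 'rV[F]_n)
    (i : 'I_k.+1) (j : 'I_n) :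
  scroll_vec k z w 0 (mxvec_index i j) =
  z 0 0 ^+ (k - i) * z 0 1 ^+ i * w 0 j.
Proof. by rewrite /scroll_vec /segre_vec mxvecE !mxE. Qed.

Lemma sum_mxvec (V : nmodType) (m n : nat) (f : 'I_(m * n) -> V) :
  \sum_l f l = \sum_(i < m) \sum_(j < n) f (mxvec_index i j).
Proof.
rewrite pair_big /= (reindex (fun p => mxvec_index p.1 p.2)) //=.
have [h H1 H2] := curry_mxvec_bij m n.
exists h => [[i j] _|p _]; first exact: (H1 (i, j)).
by rewrite -[RHS]H2 //; case: (h p).
Qed.

Lemma scroll_vec0 (F : fieldType) (k n : nat) (z : 'rV[F]_2) :
  scroll_vec k z (0 : 'rV[F]_n) = 0.
Proof.
by apply/rowP => l; case/mxvec_indexP: l => i j; rewrite scroll_vecE !mxE mulr0.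
Qed.

Lemma scroll_vecZ (F : fieldType) (k n : nat) (c d : F) (z : 'rV[F]_2)
    (w : 'rV[F]_n) :
  scroll_vec k (c *: z) (d *: w) = (c ^+ k * d) *: scroll_vec k z w.
Proof.
apply/rowP => l; case/mxvec_indexP: l => i j; rewrite [RHS]mxE !scroll_vecE.
rewrite !mxE !exprMn.
have -> : c ^+ k = c ^+ (k - i) * c ^+ i by rewrite -exprD subnK // -ltnS.
by ring.
Qed.

Lemma scroll_vec_neq0 (F : fieldType) (k n : nat) (z : 'rV[F]_2)
    (w : 'rV[F]_n) :
  z != 0 -> w != 0 -> scroll_vec k z w != 0.
Proof. by move=> z0 w0; apply: segre_vec_neq0 => //; exact: veronese_vec_neq0. Qed.

Lemma proj_pt_rep (F : fieldType) (N : nat) (p : proj F N) :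
  proj_pt (proj_rep_neq0 p) = p.
Proof.
apply: val_inj => /=; apply/eqP; rewrite eqEdim dim_vline proj_rep_neq0.
rewrite -memvE memv_pick /=; by case: p => V /= /eqP ->.
Qed.

(** Trades the representatives chosen by [proj_rep] for arbitrary nonzero vectors. *)
Lemma XknP (F : fieldType) (k n : nat) (p : proj F (k.+1 * n)) :
  Xkn F k n p <-> exists (z : 'rV[F]_2) (w : 'rV[F]_n) (z0 : z != 0)
    (w0 : w != 0), p = proj_pt (scroll_vec_neq0 k z0 w0).
Proof.
split=> [[_ [r _ <-] [q _ <-]]|[z [w [z0 [w0 ->]]]]].
  exists (proj_rep r), (proj_rep q), (proj_rep_neq0 r), (proj_rep_neq0 q).
  rewrite -[in LHS](proj_pt_rep r) veroneseE -[in LHS](proj_pt_rep q) segreE.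
  exact: val_inj.
exists (veronese k (proj_pt z0)); first by exists (proj_pt z0).
exists (proj_pt w0) => //.
by rewrite veroneseE segreE; exact: val_inj.
Qed.

Lemma Xkn_rep (F : fieldType) (k n : nat) (p : proj F (k.+1 * n)) :
  Xkn F k n p -> exists (z : 'rV[F]_2) (w : 'rV[F]_n),
    [/\ z != 0, w != 0 & proj_rep p = scroll_vec k z w].
Proof.
case/XknP => z [w [z0 [w0 ->]]].
have [c c0 ->] := proj_repP (scroll_vec_neq0 k z0 w0).
exists z, (c *: w); split=> //; first by rewrite scaler_eq0 negb_or c0.
by rewrite -[z in RHS]scale1r scroll_vecZ expr1n mul1r.
Qed.

Lemma dhomog_mevalZ (F : comNzRingType) (N d : nat) (f : {mpoly F[N]})
    (c : F) (v : 'I_N -> F) :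
  f \is d.-homog -> f.@[fun i => c * v i] = c ^+ d * f.@[v].
Proof.
move/dhomogP => hf; rewrite !mevalE mulr_sumr.
rewrite big_seq [RHS]big_seq; apply: eq_bigr => m /hf /= <-.
rewrite [RHS]mulrCA; congr (_ * _).
rewrite mdegE /= -prodrXr -big_split /=.
by apply: eq_bigr => i _; rewrite exprMn.
Qed.

Lemma row2_eq0 (R : nmodType) (z : 'rV[R]_2) :
  z 0 0 = 0 -> z 0 1 = 0 -> z = 0.
Proof.
move=> z0 z1; apply/rowP => -[[|[|//]] hs]; rewrite mxE.
  by rewrite -z0; congr (z _ _); exact: val_inj.
by rewrite -z1; congr (z _ _); exact: val_inj.
Qed.

(** Quadrics alone force the decomposition: they make the ratio of [M i.+1 j] to [M i j] equal to
    one ratio z1 : z0 for all i and j, so for each j the entries form a geometric progression in i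
    with that common ratio. *)
Lemma affine_cone_Xkn (F : fieldType) (k n : nat) (x : 'rV[F]_(k.+1 * n)) :
  (0 < n)%N ->
  affine_cone (Xkn F k n) x <->
  exists (z : 'rV[F]_2) (w : 'rV[F]_n), z != 0 /\ x = scroll_vec k z w.
Proof.
move=> n0; split; last first.
  case=> z [w [z0 ->]] d f hf fX.
  have [w0|w0] := eqVneq w 0.
    (* At the vertex only d = 0 matters, where f is constant; that this constant is 0 needs an
       actual point of the variety, which the all-ones vector supplies. *)
    have e0 : const_mx 1 != 0 :> 'rV[F]_n.
      apply/eqP => /rowP/(_ (Ordinal n0)).
      by rewrite !mxE => /eqP; rewrite oner_eq0.
    have Xp : Xkn F k n (proj_pt (scroll_vec_neq0 k z0 e0)).
      by apply/XknP; exists z, (const_mx 1), z0, e0.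
    have := fX _ Xp; set r := proj_rep _ => fr0.
    rewrite w0 scroll_vec0 -(meval_eq (v1 := fun i => 0 * r 0 i)); last first.
      by move=> i; rewrite mul0r mxE.
    by rewrite (dhomog_mevalZ _ _ hf) fr0 mulr0.
  have Xp : Xkn F k n (proj_pt (scroll_vec_neq0 k z0 w0)).
    by apply/XknP; exists z, w, z0, w0.
  have := fX _ Xp; have [c c0 ->] := proj_repP (scroll_vec_neq0 k z0 w0).
  rewrite (meval_eq (v2 := fun i => c * scroll_vec k z w 0 i)); last first.
    by move=> i; rewrite mxE.
  rewrite (dhomog_mevalZ _ _ hf) => /eqP.
  by rewrite mulf_eq0 expf_eq0 (negPf c0) andbF => /eqP.
move=> cx.
pose M (i : nat) j : F := x 0 (mxvec_index (inord i : 'I_k.+1) j).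
(* The 2 x 2 minors of the two-row matrix with columns ([M i j], [M i.+1 j]), whose rows are
   proportional on the variety. *)
have minor (i i' : nat) (j j' : 'I_n) : (i < k)%N -> (i' < k)%N ->
    M i.+1 j * M i' j' = M i j * M i'.+1 j'.
  move=> ik i'k.
  pose X (l : nat) (s : 'I_n) : {mpoly F[k.+1 * n]} :=
    'X_(mxvec_index (inord l : 'I_k.+1) s).
  have hX l s l' s' : X l s * X l' s' \is 2.-homog.
    by apply: (@dhomogM _ _ _ 1 _ 1); rewrite dhomogX /= mdeg1.
  have := cx 2 (X i.+1 j * X i' j' - X i j * X i'.+1 j').
  rewrite mevalB !mevalM !mevalXU => h.
  apply/eqP; rewrite -subr_eq0; apply/eqP; apply: h.
    by rewrite rpredB.
  move=> p /Xkn_rep[z [w [_ _ ->]]].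
  rewrite mevalB !mevalM !mevalXU !scroll_vecE !inordK ?ltnS //; last 2 first.
  - exact: ltnW.
  - exact: ltnW.
  rewrite (_ : k - i = (k - i.+1).+1)%N; last by rewrite -subSn.
  rewrite (_ : k - i' = (k - i'.+1).+1)%N; last by rewrite -subSn.
  by rewrite !exprS; ring.
have [z [z0 zM]] : exists z : 'rV[F]_2, z != 0 /\
    forall (i : nat) (j : 'I_n), (i < k)%N -> M i.+1 j * z 0 0 = M i j * z 0 1.
  have [[i [j [ik Mij]]]|nM] :=
    pselect (exists i j, (i < k)%N /\ M i j != 0).
    (* A nonzero column of that matrix gives the ratio, and the minors carry it to all the
       others. *)
    exists (\row_s (if s == 0 then M i j else M i.+1 j)); split.
      by apply/rV0Pn; exists 0; rewrite mxE eqxx.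
    by move=> i' j' i'k; rewrite !mxE /=; exact: minor.
  (* Only the entries with i = k can survive, so the point lies over (0 : 1). *)
  exists (\row_s (if s == 0 then 0 else 1)); split.
    by apply/rV0Pn; exists 1; rewrite mxE /= oner_eq0.
  move=> i j ik; rewrite !mxE /= mulr0 mulr1.
  apply/esym/eqP/negPn/negP => Mij; apply: nM; by exists i, j.
exists z; have [z00|z00] := eqVneq (z 0 0) 0.
  have z01 : z 0 1 != 0.
    by apply: contra_neq z0; exact: row2_eq0.
  exists (\row_j (M k j / z 0 1 ^+ k)); split=> //.
  apply/rowP => l; case/mxvec_indexP: l => i j; rewrite scroll_vecE z00 mxE.
  have [ik|] := ltnP i k.
    rewrite expr0n subn_eq0 leqNgt ik /= !mul0r.
    have /esym/eqP := zM i j ik; rewrite z00 mulr0 mulf_eq0 (negPf z01) orbF.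
    by move=> /eqP; rewrite /M inord_val.
  move=> ki; have Ei : i = k :> nat.
    by apply/eqP; rewrite eqn_leq ki -ltnS ltn_ord.
  have <- : M i j = x 0 (mxvec_index i j) by rewrite /M inord_val.
  by rewrite Ei subnn expr0 mul1r mulrC divfK ?expf_neq0.
exists (\row_j (M 0 j / z 0 0 ^+ k)); split=> //.
have zM' (i : nat) (j : 'I_n) : (i <= k)%N ->
    M i j = M 0 j * (z 0 1 / z 0 0) ^+ i.
  elim: i => [|i IH] ik; first by rewrite expr0 mulr1.
  apply: (mulIf z00); rewrite zM // (IH (ltnW ik)) exprSr -!mulrA.
  by rewrite [_^-1 * _]mulVf // mulr1.
apply/rowP => l; case/mxvec_indexP: l => i j; rewrite scroll_vecE mxE.
have ik : (i <= k)%N by rewrite -ltnS.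
have -> : x 0 (mxvec_index i j) = M i j by rewrite /M inord_val.
rewrite zM' //; have <- : z 0 0 ^+ (k - i) * z 0 0 ^+ i = z 0 0 ^+ k.
  by rewrite -exprD subnK.
rewrite expr_div_n; field.
by rewrite !expf_neq0.
Qed.

(** * The weighted norm on the cones *)

Definition sqnormc (R : realType) (x : R[i]) : R :=
  complex.Re x ^+ 2 + complex.Im x ^+ 2.

Definition sqnorm (R : realType) (N : nat) (v : 'rV[R[i]]_N) : R :=
  \sum_(j < N) sqnormc (v 0 j).

Definition hermitian (R : realType) (N : nat) (v w : 'rV[R[i]]_N) : R[i] :=
  \sum_(j < N) v 0 j * conjc (w 0 j).

Lemma sqnormc_ge0 (R : realType) (x : R[i]) : 0 <= sqnormc x.
Proof. by rewrite addr_ge0 ?sqr_ge0. Qed.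

Lemma sqnormcM (R : realType) (x y : R[i]) :
  sqnormc (x * y) = sqnormc x * sqnormc y.
Proof. by case: x y => [a b] [c d]; rewrite /sqnormc /=; ring. Qed.

Lemma sqnormc1 (R : realType) : sqnormc (1 : R[i]) = 1.
Proof. by rewrite /sqnormc /=; ring. Qed.

Lemma sqnormcX (R : realType) (x : R[i]) (m : nat) :
  sqnormc (x ^+ m) = sqnormc x ^+ m.
Proof.
elim: m => [|m IH]; first exact: sqnormc1.
by rewrite !exprS sqnormcM IH.
Qed.

Lemma sqnormc_conj (R : realType) (x : R[i]) : sqnormc (conjc x) = sqnormc x.
Proof. by case: x => a b; rewrite /sqnormc /= sqrrN. Qed.

Lemma sqnormcD_le (R : realType) (x y : R[i]) :
  sqnormc (x + y) <= 2 * sqnormc x + 2 * sqnormc y.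
Proof.
case: x y => [a b] [c d]; rewrite /sqnormc /= -subr_ge0.
rewrite (_ : _ - _ = (a - c) ^+ 2 + (b - d) ^+ 2); last by ring.
by rewrite addr_ge0 ?sqr_ge0.
Qed.

Lemma sqnormcN (R : realType) (x : R[i]) : sqnormc (- x) = sqnormc x.
Proof. by case: x => a b; rewrite /sqnormc /= !sqrrN. Qed.

Lemma mulc_conj (R : realType) (x : R[i]) : x * conjc x = (sqnormc x)%:C%C.
Proof.
by case: x => a b; apply/eqP; rewrite eq_complex /sqnormc /=; apply/andP; split;
  apply/eqP; ring.
Qed.

Lemma sqnormc_eq0 (R : realType) (x : R[i]) : sqnormc x = 0 -> x = 0.
Proof.
case: x => a b /eqP; rewrite /sqnormc /= paddr_eq0 ?sqr_ge0 // !sqrf_eq0.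
by case/andP => /eqP -> /eqP ->.
Qed.

Lemma sqnorm_ge0 (R : realType) (N : nat) (v : 'rV[R[i]]_N) : 0 <= sqnorm v.
Proof. by apply: sumr_ge0 => j _; exact: sqnormc_ge0. Qed.

Lemma sqnorm_eq0 (R : realType) (N : nat) (v : 'rV[R[i]]_N) :
  sqnorm v = 0 -> v = 0.
Proof.
move=> /eqP; rewrite psumr_eq0 => [/allP h|j _]; last exact: sqnormc_ge0.
apply/rowP => j; rewrite mxE; apply: sqnormc_eq0; apply/eqP.
by apply: h; rewrite mem_index_enum.
Qed.

Lemma sqnorm0 (R : realType) (N : nat) : sqnorm (0 : 'rV[R[i]]_N) = 0.
Proof.
by apply: big1 => j _; rewrite mxE /sqnormc /= expr0n /= addr0.
Qed.

Lemma sqnormN (R : realType) (N : nat) (v : 'rV[R[i]]_N) :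
  sqnorm (- v) = sqnorm v.
Proof. by apply: eq_bigr => j _; rewrite mxE sqnormcN. Qed.

Lemma sqnormZ (R : realType) (N : nat) (c : R[i]) (v : 'rV[R[i]]_N) :
  sqnorm (c *: v) = sqnormc c * sqnorm v.
Proof. by rewrite /sqnorm mulr_sumr; apply: eq_bigr => j _; rewrite mxE sqnormcM. Qed.

Lemma sqnormD_le (R : realType) (N : nat) (v w : 'rV[R[i]]_N) :
  sqnorm (v + w) <= 2 * sqnorm v + 2 * sqnorm w.
Proof.
rewrite /sqnorm !mulr_sumr -big_split /=; apply: ler_sum => j _.
by rewrite mxE sqnormcD_le.
Qed.

Lemma cdistE (R : realType) (p : nat) (x y : 'rV[R[i]]_p) :
  cdist x y = Num.sqrt (sqnorm (x - y)).
Proof.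
rewrite /cdist /euclid_dist big_split_ord /=; congr Num.sqrt.
rewrite /sqnorm -big_split /=; apply: eq_bigr => j _.
rewrite /realify !row_mxEl !row_mxEr !mxE /sqnormc.
by case: (x 0 j) (y 0 j) => [a b] [c d].
Qed.

Lemma hermitianBB (R : realType) (N : nat) (v w : 'rV[R[i]]_N) :
  hermitian (v - w) (v - w) =
  hermitian v v + hermitian w w - hermitian v w - hermitian w v.
Proof.
rewrite /hermitian -big_split -!sumrB /=; apply: eq_bigr => j _.
by rewrite !mxE rmorphB /=; ring.
Qed.

Lemma hermitian_sqnorm (R : realType) (N : nat) (v : 'rV[R[i]]_N) :
  hermitian v v = (sqnorm v)%:C%C.
Proof.
rewrite /hermitian /sqnorm rmorph_sum; apply: eq_bigr => j _; exact: mulc_conj.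
Qed.

Lemma hermitianC (R : realType) (N : nat) (v w : 'rV[R[i]]_N) :
  hermitian w v = conjc (hermitian v w).
Proof.
rewrite /hermitian rmorph_sum; apply: eq_bigr => j _.
by rewrite rmorphM /= conjcK mulrC.
Qed.

Lemma hermitianZr (R : realType) (N : nat) (c : R[i]) (v w : 'rV[R[i]]_N) :
  hermitian v (c *: w) = conjc c * hermitian v w.
Proof.
rewrite /hermitian mulr_sumr; apply: eq_bigr => j _.
by rewrite mxE rmorphM /= mulrCA.
Qed.

(* The binomial weights turn the Veronese map into a power map on Hermitian
   products. *)
Lemma hermitian_scroll (R : realType) (k n : nat) (z z' : 'rV[R[i]]_2)
    (w w' : 'rV[R[i]]_n) :
  \sum_(i < k.+1) \sum_(j < n)
     'C(k, i)%:R * (scroll_vec k z w 0 (mxvec_index i j) *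
                   conjc (scroll_vec k z' w' 0 (mxvec_index i j))) =
  hermitian z z' ^+ k * hermitian w w'.
Proof.
have -> : hermitian z z' = z 0 0 * conjc (z' 0 0) + z 0 1 * conjc (z' 0 1).
  rewrite /hermitian !big_ord_recl big_ord0 addr0.
  by rewrite (_ : lift 0 0 = 1) //; exact: val_inj.
rewrite exprDn mulr_suml.
apply: eq_bigr => i _; rewrite /hermitian mulr_sumr; apply: eq_bigr => j _.
rewrite !scroll_vecE !rmorphM !rmorphXn /= !exprMn -mulr_natl.
ring.
Qed.

(** The squared Euclidean norm on symmetric tensors: among the coordinates of the k-th tensor power
    of z, the monomial number i occurs 'C(k, i) times. *)
Definition bombieri (R : realType) (k n : nat) (x : 'rV[R[i]]_(k.+1 * n)) : R :=
  \sum_(i < k.+1) \sum_(j < n) 'C(k, i)%:R * sqnormc (x 0 (mxvec_index i j)).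

Lemma sqnorm_le_bombieri (R : realType) (k n : nat) (x : 'rV[R[i]]_(k.+1 * n)) :
  sqnorm x <= bombieri x.
Proof.
rewrite /sqnorm sum_mxvec; apply: ler_sum => i _; apply: ler_sum => j _.
by rewrite ler_peMl ?sqnormc_ge0 // ler1n bin_gt0 -ltnS.
Qed.

Lemma bombieri_le_sqnorm (R : realType) (k n : nat) (x : 'rV[R[i]]_(k.+1 * n)) :
  bombieri x <= 2 ^+ k * sqnorm x.
Proof.
rewrite /sqnorm sum_mxvec mulr_sumr; apply: ler_sum => i _.
rewrite mulr_sumr; apply: ler_sum => j _.
rewrite ler_wpM2r ?sqnormc_ge0 // -natrX ler_nat.
have -> : (2 ^ k = \sum_(l < k.+1) 'C(k, l))%N.
  rewrite -[2%N]/(1 + 1)%N expnDn; apply: eq_bigr => l _.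
  by rewrite !exp1n !muln1.
by rewrite (bigD1 i) //= leq_addr.
Qed.

Lemma bombieri_scrollB (R : realType) (k n : nat) (t : R)
    (z z' : 'rV[R[i]]_2) (w w' : 'rV[R[i]]_n) :
  sqnorm z = 1 -> sqnorm z' = 1 -> hermitian z z' = t%:C%C ->
  bombieri (scroll_vec k z w - scroll_vec k z' w') =
  (1 - t ^+ k) * (sqnorm w + sqnorm w') + t ^+ k * sqnorm (w - w').
Proof.
move=> hz hz' hzz'; apply: complexI.
have -> : (bombieri (scroll_vec k z w - scroll_vec k z' w'))%:C%C =
    \sum_(i < k.+1) \sum_(j < n) 'C(k, i)%:R *
      (sqnormc ((scroll_vec k z w - scroll_vec k z' w') 0
        (mxvec_index i j)))%:C%C.
  rewrite /bombieri rmorph_sum; apply: eq_bigr => i _; rewrite rmorph_sum.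
  by apply: eq_bigr => j _; rewrite rmorphM /= rmorph_nat.
pose G (u : 'rV[R[i]]_2) (v : 'rV[R[i]]_n) u' v' : R[i] := \sum_(i < k.+1) \sum_(j < n)
  'C(k, i)%:R * (scroll_vec k u v 0 (mxvec_index i j) *
    conjc (scroll_vec k u' v' 0 (mxvec_index i j))).
have GE u v u' v' : G u v u' v' = hermitian u u' ^+ k * hermitian v v'.
  exact: (hermitian_scroll k u u' v v').
transitivity (G z w z w + G z' w' z' w' - G z w z' w' - G z' w' z w).
  rewrite /G -big_split -!sumrB /=; apply: eq_bigr => i _.
  rewrite -big_split -!sumrB /=; apply: eq_bigr => j _; rewrite -mulc_conj.
  move: (scroll_vec k z w) (scroll_vec k z' w') => x y.
  by rewrite !mxE rmorphB /=; ring.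
rewrite !GE.
rewrite (hermitianC z z') hzz' !hermitian_sqnorm hz hz' conjc_real !expr1n.
rewrite !mul1r rmorphD !rmorphM rmorphB rmorphD /= rmorph1 rmorphXn /=.
rewrite -(hermitian_sqnorm (w - w')) hermitianBB !hermitian_sqnorm.
ring.
Qed.

Lemma hermitian_phase (R : realType) (N : nat) (z z' : 'rV[R[i]]_N) :
  exists2 c : R[i], sqnormc c = 1 &
    exists2 t : R, 0 <= t & hermitian z (c *: z') = t%:C%C.
Proof.
have [h0|h0] := eqVneq (hermitian z z') 0.
  exists 1; first exact: sqnormc1.
  by exists 0 => //; rewrite scale1r h0.
set h := hermitian z z' in h0 *.
have sh0 : 0 < sqnormc h.
  rewrite lt_neqAle sqnormc_ge0 andbT eq_sym; apply: contra_neq h0.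
  exact: sqnormc_eq0.
have r0 : 0 < Num.sqrt (sqnormc h) by rewrite sqrtr_gt0.
set r := Num.sqrt (sqnormc h) in r0.
have rr : r ^+ 2 = sqnormc h by rewrite sqr_sqrtr // ltW.
(* The phase h / |h|: the product is conjugate-linear in its second argument, so it becomes conj(h)
   h / |h| = |h|. *)
exists (h * (r^-1)%:C%C).
  rewrite sqnormcM -rr /sqnormc /= expr0n addr0 exprVn mulfV //.
  by rewrite expf_neq0 // gt_eqF.
exists r; first exact: ltW.
rewrite hermitianZr -/h.
have -> : conjc (h * (r^-1)%:C%C) = conjc h * (r^-1)%:C%C.
  by rewrite [LHS]rmorphM; congr (_ * _); exact: conjc_real.
rewrite mulrAC [_ * h]mulrC mulc_conj -rr.
by rewrite -rmorphM /= expr2 mulfK // gt_eqF.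
Qed.

Lemma sqnormB_unit (R : realType) (N : nat) (t : R) (z z' : 'rV[R[i]]_N) :
  sqnorm z = 1 -> sqnorm z' = 1 -> hermitian z z' = t%:C%C ->
  sqnorm (z - z') = 2 - 2 * t.
Proof.
move=> hz hz' hzz'; apply: complexI; rewrite -hermitian_sqnorm hermitianBB.
rewrite (hermitianC z z') hzz' conjc_real !hermitian_sqnorm hz hz'.
by rewrite rmorphB rmorphM /= rmorph_nat rmorph1; ring.
Qed.

(** As k > 0, t^k <= t, so 1 - t^k is at least 1 - t = |z - z'|^2 / 2. The identity for the weighted
    norm has only t^k |w - w'|^2; the missing part (1 - t^k) |w - w'|^2 is paid for by |w - w'|^2 <=
    2 |w|^2 + 2 |w'|^2. *)
Lemma bombieri_scroll_ge (R : realType) (k n : nat) (t : R)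
    (z z' : 'rV[R[i]]_2) (w w' : 'rV[R[i]]_n) :
  (0 < k)%N ->
  sqnorm z = 1 -> sqnorm z' = 1 -> 0 <= t -> hermitian z z' = t%:C%C ->
  sqnorm (z - z') * (sqnorm w + sqnorm w') + sqnorm (w - w') <=
  6 * bombieri (scroll_vec k z w - scroll_vec k z' w').
Proof.
move=> k0 hz hz' t0 hzz'.
have E := sqnormB_unit hz hz' hzz'.
have t1 : t <= 1 by have := sqnorm_ge0 (z - z'); rewrite E; lra.
have tk : t ^+ k <= t by rewrite -{2}[t]expr1 ler_wiXn2l.
have tk0 : 0 <= t ^+ k by rewrite exprn_ge0.
rewrite (bombieri_scrollB _ _ _ hz hz' hzz') E.
have := sqnormD_le w (- w'); rewrite sqnormN.
have := sqnorm_ge0 w; have := sqnorm_ge0 w'; have := sqnorm_ge0 (w - w').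
move: (sqnorm _) (sqnorm _) (sqnorm _) tk tk0 => D S S' + +.
move: (t ^+ k) => u ut u0 D0 S'0 S0 DS.
nra.
Qed.

(** Bernoulli's inequality 1 - t^k <= k (1 - t), together with 1 - t = |z - z'|^2 / 2. *)
Lemma bombieri_scroll_le (R : realType) (k n : nat) (t : R)
    (z z' : 'rV[R[i]]_2) (w w' : 'rV[R[i]]_n) :
  sqnorm z = 1 -> sqnorm z' = 1 -> 0 <= t -> hermitian z z' = t%:C%C ->
  bombieri (scroll_vec k z w - scroll_vec k z' w') <=
  k%:R * sqnorm (z - z') * (sqnorm w + sqnorm w') + sqnorm (w - w').
Proof.
move=> hz hz' t0 hzz'.
have E := sqnormB_unit hz hz' hzz'.
have t1 : t <= 1 by have := sqnorm_ge0 (z - z'); rewrite E; lra.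
have tk1 : t ^+ k <= 1 by rewrite exprn_ile1.
have tk0 : 0 <= t ^+ k by rewrite exprn_ge0.
have tk : 1 - t ^+ k <= k%:R * (1 - t).
  elim: (k) => [|m IH]; first by rewrite expr0 mul0r subrr.
  have tm1 : t ^+ m <= 1 by rewrite exprn_ile1.
  have tm0 : 0 <= t ^+ m by rewrite exprn_ge0.
  rewrite exprS -natr1; move: IH tm1 tm0; move: (t ^+ m) (m%:R) => u v; nra.
rewrite (bombieri_scrollB _ _ _ hz hz' hzz') E.
have := sqnorm_ge0 w; have := sqnorm_ge0 w'; have := sqnorm_ge0 (w - w').
have : 0 <= k%:R * (1 - t) by rewrite mulr_ge0 ?ler0n ?subr_ge0.
move: (sqnorm _) (sqnorm _) (sqnorm _) tk tk0 tk1 => D S S' + + +.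
move: (t ^+ k) (k%:R) => u v tk u0 u1 v0 D0 S'0 S0.
nra.
Qed.

(** * Trivialising O(-k)^n as a real bundle *)

(** Polynomial over the reals rather than over the complex numbers, so that conjugation is
    allowed. *)
Definition cpolyfun (R : realType) (N : nat) (phi : 'rV[R]_N -> R[i]) : Prop :=
  polyfun (fun x => complex.Re (phi x)) /\ polyfun (fun x => complex.Im (phi x)).

Definition cpolyfunv (R : realType) (N p : nat)
    (phi : 'rV[R]_N -> 'rV[R[i]]_p) : Prop :=
  forall j, cpolyfun (fun x => phi x 0 j).

Lemma eq_cpolyfun (R : realType) (N : nat) (f g : 'rV[R]_N -> R[i]) :
  f =1 g -> cpolyfun f -> cpolyfun g.
Proof. by move=> /funext ->. Qed.

Lemma cpolyfunD (R : realType) (N : nat) (f g : 'rV[R]_N -> R[i]) :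
  cpolyfun f -> cpolyfun g -> cpolyfun (fun x => f x + g x).
Proof.
move=> [f1 f2] [g1 g2]; split.
  have [p hp] := polyfunD f1 g1; exists p => x; rewrite -hp.
  by case: (f x) (g x) => [a b] [c d].
have [p hp] := polyfunD f2 g2; exists p => x; rewrite -hp.
by case: (f x) (g x) => [a b] [c d].
Qed.

Lemma cpolyfunN (R : realType) (N : nat) (f : 'rV[R]_N -> R[i]) :
  cpolyfun f -> cpolyfun (fun x => - f x).
Proof.
move=> [f1 f2]; split.
  by have [p hp] := polyfunN f1; exists p => x; rewrite -hp; case: (f x).
by have [p hp] := polyfunN f2; exists p => x; rewrite -hp; case: (f x).
Qed.

Lemma cpolyfunM (R : realType) (N : nat) (f g : 'rV[R]_N -> R[i]) :
  cpolyfun f -> cpolyfun g -> cpolyfun (fun x => f x * g x).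
Proof.
move=> [f1 f2] [g1 g2]; split.
  have [p hp] := polyfunD (polyfunM f1 g1) (polyfunN (polyfunM f2 g2)).
  by exists p => x; rewrite -hp; case: (f x) (g x) => [a b] [c d].
have [p hp] := polyfunD (polyfunM f1 g2) (polyfunM f2 g1).
by exists p => x; rewrite -hp; case: (f x) (g x) => [a b] [c d].
Qed.

Lemma cpolyfunX (R : realType) (N : nat) (f : 'rV[R]_N -> R[i]) (m : nat) :
  cpolyfun f -> cpolyfun (fun x => f x ^+ m).
Proof.
move=> pf; elim: m => [|m IH]; first by split; exact: polyfun_cst.
by apply: eq_cpolyfun (cpolyfunM pf IH) => x; rewrite exprS.
Qed.

Lemma cpolyfun_conj (R : realType) (N : nat) (f : 'rV[R]_N -> R[i]) :
  cpolyfun f -> cpolyfun (fun x => conjc (f x)).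
Proof.
move=> [[p f1] f2]; split; first by exists p => x; rewrite -f1; case: (f x).
by have [q hq] := polyfunN f2; exists q => x; rewrite -hq; case: (f x).
Qed.

Definition weighted_scale (R : realType) (n : nat) (a : 'I_n -> int)
    (c : R[i]) (w : 'rV[R[i]]_n) : 'rV[R[i]]_n :=
  \row_j (c ^ a j * w 0 j).

(* The weight vector [a] stands for the bundle over P^1 whose total space is
   the quotient of S^3 x C^n by the circle acting through z |-> c z and
   [weighted_scale a c]; the weight -k gives O(-k), whose points are the
   v_k(z) w. [bundle_iso] is an isomorphism of the underlying real bundles. *)
Definition bundle_iso (R : realType) (n : nat) (a b : 'I_n -> int)
    (T : 'rV[R[i]]_2 -> 'rV[R[i]]_n -> 'rV[R[i]]_n) : Prop :=
  [/\ (forall N (z : 'rV[R]_N -> 'rV[R[i]]_2) (w : 'rV[R]_N -> 'rV[R[i]]_n),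
        cpolyfunv z -> cpolyfunv w -> cpolyfunv (fun x => T (z x) (w x))),
      (forall z u, sqnorm z = 1 -> exists w, T z w = u) &
      (forall z w c, sqnormc c = 1 ->
        T (c *: z) (weighted_scale a c w) = weighted_scale b c (T z w))] /\
  [/\ (forall z, T z 0 = 0),
      (exists2 K, 0 <= K & forall z z' w w', sqnorm z = 1 -> sqnorm z' = 1 ->
        sqnorm (T z w - T z' w') <=
        K * (sqnorm (z - z') * sqnorm w + sqnorm (w - w'))) &
      (exists2 K, 0 <= K & forall z z' w w', sqnorm z = 1 -> sqnorm z' = 1 ->
        sqnorm (w - w') <=
        K * (sqnorm (z - z') * sqnorm w + sqnorm (T z w - T z' w')))].

(** The error terms weighted by |w|^2 survive composition because |T z w|^2 <= K |w|^2, which is the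
    Lipschitz bound at z = z', w' = 0. *)
Lemma bundle_iso_comp (R : realType) (n : nat) (a b c : 'I_n -> int)
    (T U : 'rV[R[i]]_2 -> 'rV[R[i]]_n -> 'rV[R[i]]_n) :
  bundle_iso a b T -> bundle_iso b c U -> bundle_iso a c (fun z w => U z (T z w)).
Proof.
move=> [[pT sT eT] [T0 [K K0 LT] [K' K'0 IT]]].
move=> [[pU sU eU] [U0 [L L0 LU] [L' L'0 IU]]].
have Tle z w : sqnorm z = 1 -> sqnorm (T z w) <= K * sqnorm w.
  move=> hz; have := LT z z w 0 hz hz.
  by rewrite T0 !subr0 subrr sqnorm0 mul0r add0r.
split; split.
- by move=> N z w pz pw; apply: pU => //; exact: pT.
- move=> z u hz; have [v <-] := sU z u hz; have [w <-] := sT z v hz.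
  by exists w.
- by move=> z w d hd; rewrite eT // eU.
- by move=> z; rewrite T0 U0.
- exists (L * (K + K)) => [|z z' w w' hz hz']; first by rewrite mulr_ge0 ?addr_ge0.
  apply: (le_trans (LU z z' _ _ hz hz')); rewrite -mulrA ler_wpM2l //.
  have := LT z z' w w' hz hz'; have := Tle z w hz.
  have := sqnorm_ge0 (z - z'); have := sqnorm_ge0 (w - w').
  have := sqnorm_ge0 w.
  move: (sqnorm (T z w)) (sqnorm (T z w - T z' w')) => t1 t2.
  move: (sqnorm w) (sqnorm (w - w')) (sqnorm (z - z')) => s1 s2 s3 h1 h2 h3 h4 h5.
  have h6 : s3 * t1 <= s3 * (K * s1) by rewrite ler_wpM2l.
  have h7 : 0 <= K * s2 by rewrite mulr_ge0.
  lra.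
- exists (K' * (1 + L' * (K + 1))) => [|z z' w w' hz hz'].
    by rewrite !(mulr_ge0, addr_ge0).
  apply: (le_trans (IT z z' _ _ hz hz')); rewrite -mulrA ler_wpM2l //.
  have := IU z z' (T z w) (T z' w') hz hz'; have := Tle z w hz.
  have := sqnorm_ge0 (z - z'); have := sqnorm_ge0 w.
  have := sqnorm_ge0 (U z (T z w) - U z' (T z' w')).
  move: (sqnorm (T z w)) (sqnorm (T z w - T z' w')) => t1 t2.
  move: (sqnorm (U z _ - _)) (sqnorm w) (sqnorm (z - z')) => s1 s2 s3 h1 h2 h3 h4 h5.
  have h6 : L' * (s3 * t1) <= L' * (s3 * (K * s2)) by rewrite !ler_wpM2l.
  have h7 : 0 <= L' * (s3 * s2) by rewrite !mulr_ge0.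
  have h8 : 0 <= L' * K * s1 by rewrite !mulr_ge0.
  lra.
Qed.

Lemma unitc_neq0 (R : realType) (c : R[i]) : sqnormc c = 1 -> c != 0.
Proof.
move=> hc; apply: contra_eq_neq hc => ->.
by rewrite /sqnormc /= expr0n addr0 eq_sym oner_eq0.
Qed.

Lemma conjc_unit (R : realType) (c : R[i]) :
  sqnormc c = 1 -> conjc c = c^-1.
Proof.
move=> hc; have c0 := unitc_neq0 hc.
by apply: (mulfI c0); rewrite mulc_conj hc mulfV.
Qed.

Definition conj_coord (R : realType) (n : nat) (j : 'I_n) (w : 'rV[R[i]]_n) :
  'rV[R[i]]_n := \row_l (if l == j then conjc (w 0 l) else w 0 l).

Lemma sqnorm_conj_coord (R : realType) (n : nat) (j : 'I_n)
    (w w' : 'rV[R[i]]_n) :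
  sqnorm (conj_coord j w - conj_coord j w') = sqnorm (w - w').
Proof.
apply: eq_bigr => l _; rewrite !mxE; case: ifP => // _.
by rewrite -[in LHS]rmorphB sqnormc_conj.
Qed.

(** On the unit circle conj(c^a) = c^(-a). This is the step that leaves complex bundles for real
    ones. *)
Lemma bundle_iso_conj (R : realType) (n : nat) (a b : 'I_n -> int) (j : 'I_n) :
  b j = - a j -> (forall l, l != j -> b l = a l) ->
  bundle_iso a b (fun (_ : 'rV[R[i]]_2) => conj_coord j).
Proof.
move=> bj bl; split; split.
- move=> N z w pz pw l.
  rewrite (_ : (fun _ => _) =
    if l == j then (fun x => conjc (w x 0 l)) else (fun x => w x 0 l)).
    by case: ifP => // _; exact: cpolyfun_conj.
  by apply/funext => x; rewrite mxE; case: ifP.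
- move=> z u _; exists (conj_coord j u); apply/rowP => l; rewrite !mxE.
  by case: (l == j) => //; exact: conjcK.
- move=> z w c hc; apply/rowP => l; rewrite !mxE.
  case: eqP => [->|/eqP lj]; last by rewrite bl.
  rewrite bj rmorphM -exprz_inv -conjc_unit //.
  by congr (_ * _); rewrite [LHS]fmorphXz.
- move=> z; apply/rowP => l; rewrite !mxE; case: ifP => // _; exact: conjc0.
- exists 1 => // z z' w w' _ _; rewrite mul1r sqnorm_conj_coord lerDr.
  by rewrite mulr_ge0 ?sqnorm_ge0.
- exists 1 => // z z' w w' _ _; rewrite mul1r sqnorm_conj_coord lerDr.
  by rewrite mulr_ge0 ?sqnorm_ge0.
Qed.

(* In coordinates (i, j) this is the matrix of the quaternion p + q J. *)
Definition quat_coords (R : realType) (n : nat) (i j : 'I_n) (p q : R[i])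
    (w : 'rV[R[i]]_n) : 'rV[R[i]]_n :=
  \row_l (if l == i then p * w 0 i - conjc q * w 0 j
          else if l == j then q * w 0 i + conjc p * w 0 j else w 0 l).

(** Multiplicativity of the quaternion norm, that is, Euler's four-square identity. *)
Lemma sqnorm_quat (R : realType) (p q x y : R[i]) :
  sqnormc (p * x - conjc q * y) + sqnormc (q * x + conjc p * y) =
  (sqnormc p + sqnormc q) * (sqnormc x + sqnormc y).
Proof.
case: p q x y => [p1 p2] [q1 q2] [x1 x2] [y1 y2].
by rewrite /sqnormc /=; ring.
Qed.

Lemma sqnormcXB_le (R : realType) (m : nat) :
  exists2 K : R, 0 <= K & forall x y : R[i], sqnormc x <= 1 -> sqnormc y <= 1 ->
    sqnormc (x ^+ m - y ^+ m) <= K * sqnormc (x - y).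
Proof.
elim: m => [|m [K K0 IH]].
  by exists 0 => // x y _ _; rewrite subrr /sqnormc /= expr0n addr0 mul0r.
exists (2 * K + 2) => [|x y hx hy]; first by rewrite addr_ge0 ?mulr_ge0.
have -> : x ^+ m.+1 - y ^+ m.+1 = x * (x ^+ m - y ^+ m) + (x - y) * y ^+ m.
  by rewrite !exprS; ring.
apply: (le_trans (sqnormcD_le _ _)); rewrite !sqnormcM sqnormcX.
have := IH x y hx hy; have := sqnormc_ge0 (x ^+ m - y ^+ m).
have : sqnormc y ^+ m <= 1 by rewrite exprn_ile1 ?sqnormc_ge0.
have := sqnormc_ge0 (x - y); have := sqnormc_ge0 x.
move: (sqnormc y ^+ m) (sqnormc x) (sqnormc (x - y)) (sqnormc (x ^+ m - y ^+ m))
  hx => u v d e.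
move=> v1 v0 d0 u1 e0 he.
have h1 : v * e <= e by rewrite ler_piMl.
have h2 : d * u <= d by rewrite ler_piMr.
lra.
Qed.

Lemma sqnorm2E (R : realType) (z : 'rV[R[i]]_2) :
  sqnorm z = sqnormc (z 0 0) + sqnormc (z 0 1).
Proof.
rewrite /sqnorm !big_ord_recl big_ord0 addr0.
by rewrite (_ : lift 0 0 = 1) //; exact: val_inj.
Qed.

(** One of x, y is at least 1/2. Applied to |z0|^2 and |z1|^2, it keeps the quaternion (z0^m, z1^m)
    away from 0 on the unit sphere. *)
Lemma sum_pow_ge (R : realType) (m : nat) (x y : R) :
  0 <= x -> 0 <= y -> x + y = 1 -> 2^-1 ^+ m <= x ^+ m + y ^+ m.
Proof.
move=> x0 y0 xy.
have h (v : R) : 0 <= v -> 2^-1 <= v -> 2^-1 ^+ m <= v ^+ m.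
  by move=> v0 hv; rewrite lerXn2r // nnegrE // invr_ge0.
have [hx|hx] := lerP 2^-1 x.
  by apply: (le_trans (h x x0 hx)); rewrite lerDl exprn_ge0.
apply: (le_trans (h y y0 _)); last by rewrite lerDr exprn_ge0.
lra.
Qed.

(** z0^m and z1^m have weight m and their conjugates weight -m. The former multiply [w 0 i], of
    weight [a i], and the latter [w 0 j], of weight [a i + 2m], so all four terms have weight
    [a i + m]. *)
Lemma bundle_iso_quat (R : realType) (n : nat) (a b : 'I_n -> int)
    (i j : 'I_n) (m : nat) :
  i != j -> a j = a i + (2 * m)%:Z -> b i = a i + m%:Z -> b j = a i + m%:Z ->
  (forall l, l != i -> l != j -> b l = a l) ->
  bundle_iso a b (fun (z : 'rV[R[i]]_2) =>
    quat_coords i j (z 0 0 ^+ m) (z 0 1 ^+ m)).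
Proof.
move=> ij aj bi bj bl.
have ji : (j == i) = false by rewrite eq_sym; apply/negbTE.
pose rest (v : 'rV[R[i]]_n) := \sum_(l | (l != i) && (l != j)) sqnormc (v 0 l).
have rest0 v : 0 <= rest v by apply: sumr_ge0 => l _; exact: sqnormc_ge0.
have sq_split v : sqnorm v = sqnormc (v 0 i) + sqnormc (v 0 j) + rest v.
  rewrite /sqnorm (bigD1 i) //= (bigD1 j) /=; last by rewrite eq_sym.
  by rewrite addrA.
have sq_quat (p q : R[i]) v : sqnorm (quat_coords i j p q v) =
    (sqnormc p + sqnormc q) * (sqnormc (v 0 i) + sqnormc (v 0 j)) + rest v.
  rewrite sq_split !mxE eqxx ji eqxx sqnorm_quat; congr (_ + _).
  by apply: eq_bigr => l /andP[/negPf li /negPf lj]; rewrite mxE li lj.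
(* Separates the change of the matrix, collected in u, from the change of the vector. Quaternion
   matrices depend additively on (p, q), so the norm identity also computes the norm of u. *)
have quatB (p q p' q' : R[i]) v v' : exists2 u,
    quat_coords i j p q v - quat_coords i j p' q' v' =
      u + quat_coords i j p' q' (v - v') &
    sqnorm u = (sqnormc (p - p') + sqnormc (q - q')) *
      (sqnormc (v 0 i) + sqnormc (v 0 j)).
  exists (\row_l if (l == i) || (l == j)
    then quat_coords i j (p - p') (q - q') v 0 l else 0).
    apply/rowP => l; rewrite !mxE.
    have [_|li] := eqVneq l i; first by rewrite rmorphB /=; ring.
    have [_|lj] := eqVneq l j; first by rewrite rmorphB /=; ring.
    by rewrite /= add0r.
  rewrite sq_split !mxE !eqxx ji /= sqnorm_quat /rest big1 ?addr0 //.
  move=> l /andP[/negPf li /negPf lj]; rewrite mxE li lj /=.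
  by rewrite /sqnormc /= expr0n addr0.
have [K K0 hK] := sqnormcXB_le R m.
have hK2 (z z' : 'rV[R[i]]_2) : sqnorm z = 1 -> sqnorm z' = 1 ->
    sqnormc (z 0 0 ^+ m - z' 0 0 ^+ m) + sqnormc (z 0 1 ^+ m - z' 0 1 ^+ m) <=
    K * sqnorm (z - z').
  have zB s : (z - z') 0 s = z 0 s - z' 0 s by rewrite !mxE.
  rewrite !sqnorm2E mulrDr !zB => hz hz'.
  have := sqnormc_ge0 (z 0 0); have := sqnormc_ge0 (z 0 1).
  have := sqnormc_ge0 (z' 0 0); have := sqnormc_ge0 (z' 0 1) => *.
  by apply: lerD; apply: hK; lra.
split; split.
- move=> N z w pz pw l.
  have pzm s : cpolyfun (fun x => z x 0 s ^+ m) by apply: cpolyfunX; exact: pz.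
  have [li|li] := eqVneq l i; last have [lj|lj] := eqVneq l j.
  + apply: eq_cpolyfun (cpolyfunD (cpolyfunM (pzm 0) (pw i))
      (cpolyfunN (cpolyfunM (cpolyfun_conj (pzm 1)) (pw j)))) => x.
    by rewrite mxE li eqxx.
  + apply: eq_cpolyfun (cpolyfunD (cpolyfunM (pzm 1) (pw i))
      (cpolyfunM (cpolyfun_conj (pzm 0)) (pw j))) => x.
    by rewrite mxE (negPf li) lj eqxx.
  + by apply: eq_cpolyfun (pw l) => x; rewrite mxE (negPf li) (negPf lj).
- move=> z u hz; pose p := z 0 0 ^+ m; pose q := z 0 1 ^+ m.
  pose d := p * conjc p + q * conjc q.
  have d0 : d != 0.
    rewrite /d !mulc_conj -rmorphD /= !sqnormcX.
    have := sum_pow_ge m (sqnormc_ge0 (z 0 0)) (sqnormc_ge0 (z 0 1)).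
    rewrite -sqnorm2E => /(_ hz) h.
    rewrite eq_complex /= negb_and gt_eqF //; apply: lt_le_trans h.
    by rewrite exprn_gt0 // invr_gt0.
  (* The inverse of the 2 x 2 block is its conjugate transpose divided by its determinant d. *)
  exists (\row_l if l == i then (conjc p * u 0 i + conjc q * u 0 j) / d
     else if l == j then (p * u 0 j - q * u 0 i) / d else u 0 l).
  apply/rowP => l; rewrite !mxE !eqxx ji -/p -/q.
  have [->|li] := eqVneq l i.
    by rewrite /d; field.
  have [->|lj] := eqVneq l j => //.
  by rewrite /d; field.
- move=> z w c hc; have c0 := unitc_neq0 hc.
  apply/rowP => l; rewrite !mxE.
  have cm s : conjc ((c * s) ^+ m) = c^-1 ^+ m * conjc (s ^+ m).
    by rewrite exprMn rmorphM /= rmorphXn /= conjc_unit.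
  rewrite !cm !exprMn aj !expfzDr // -!exprnP.
  rewrite (_ : c ^+ (2 * m) = c ^+ m * c ^+ m); last by rewrite mul2n -addnn exprD.
  rewrite exprVn; have cm0 : c ^+ m != 0 by rewrite expf_neq0.
  have [->|li] := eqVneq l i.
    by rewrite bi expfzDr // -exprnP; field.
  have [->|lj] := eqVneq l j; last by rewrite bl.
  by rewrite bj expfzDr // -exprnP; field.
- move=> z; apply/rowP => l; rewrite !mxE !mulr0 subr0 addr0.
  by case: ifP => // _; case: ifP.
(* 2K bounds twice the change of the matrix; 4 is twice the bound |z0'|^(2m) + |z1'|^(2m) <= 2 on
   its squared norm. *)
- exists (2 * K + 4) => [|z z' w w' hz hz']; first by rewrite addr_ge0 ?mulr_ge0.
  have [u -> hu] := quatB (z 0 0 ^+ m) (z 0 1 ^+ m) (z' 0 0 ^+ m)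
    (z' 0 1 ^+ m) w w'.
  apply: (le_trans (sqnormD_le _ _)); rewrite hu sq_quat.
  have := hK2 z z' hz hz'.
  move: hz'; rewrite sqnorm2E !sqnormcX => hz'.
  have h0 := sqnormc_ge0 (z' 0 0); have h1 := sqnormc_ge0 (z' 0 1).
  have e0 : sqnormc (z' 0 0) ^+ m <= 1 by apply: exprn_ile1 => //; lra.
  have e1 : sqnormc (z' 0 1) ^+ m <= 1 by apply: exprn_ile1 => //; lra.
  have := rest0 w; have := rest0 (w - w').
  rewrite (sq_split w) (sq_split (w - w')).
  have := sqnormc_ge0 (w 0 i); have := sqnormc_ge0 (w 0 j).
  have := sqnormc_ge0 ((w - w') 0 i); have := sqnormc_ge0 ((w - w') 0 j).
  have := sqnorm_ge0 (z - z').
  move: (rest w) (rest (w - w')) (sqnorm (z - z')) => r r' s.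
  move: (sqnormc (w 0 i)) (sqnormc (w 0 j)) => x y.
  move: (sqnormc ((w - w') 0 i)) (sqnormc ((w - w') 0 j)) => x' y'.
  move: (_ ^+ m) (_ ^+ m) e0 e1 (_ + _) => f g f1 g1 t s0 y'0 x'0 y0 x0 r'0 r0 ts.
  have k1 : t * (x + y) <= K * s * (x + y) by rewrite ler_wpM2r ?addr_ge0.
  have k2 : (f + g) * (x' + y') <= 2 * (x' + y').
    by rewrite ler_wpM2r ?addr_ge0 //; lra.
  have k3 : 0 <= K * (s * r) by rewrite !mulr_ge0.
  have k4 : 0 <= K * (x' + y' + r') by rewrite !(mulr_ge0, addr_ge0).
  have k5 : 0 <= s * (x + y + r) by rewrite !(mulr_ge0, addr_ge0).
  lra.
(* The constant is (2^m + 1)(2K + 2): inverting the block costs 2^m in the coordinates i and j, and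
   nothing in the others. *)
- exists (2 ^+ m * (2 * K + 2) + 2 * K + 2) => [|z z' w w' hz hz'].
    by rewrite !(mulr_ge0, addr_ge0) // exprn_ge0.
  have [u E hu] := quatB (z 0 0 ^+ m) (z 0 1 ^+ m) (z' 0 0 ^+ m)
    (z' 0 1 ^+ m) w w'.
  have : quat_coords i j (z' 0 0 ^+ m) (z' 0 1 ^+ m) (w - w') =
    quat_coords i j (z 0 0 ^+ m) (z 0 1 ^+ m) w -
    quat_coords i j (z' 0 0 ^+ m) (z' 0 1 ^+ m) w' + - u.
    by rewrite E [u + _]addrC addrK.
  set Q := _ - quat_coords _ _ _ _ _.
  move/(congr1 (@sqnorm R n)); rewrite sq_quat.
  have := sqnormD_le Q (- u); rewrite sqnormN hu.
  have := hK2 z z' hz hz'.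
  move: hz'; rewrite sqnorm2E => hz'.
  have := sum_pow_ge m (sqnormc_ge0 _) (sqnormc_ge0 _) hz'.
  rewrite -!sqnormcX exprVn.
  have : 0 <= 2 ^+ m :> R by rewrite exprn_ge0.
  have : 2 ^+ m * (2 ^+ m)^-1 = 1 :> R by rewrite mulfV // expf_neq0 // pnatr_eq0.
  have := rest0 w; have := rest0 (w - w').
  rewrite (sq_split w) (sq_split (w - w')).
  have := sqnormc_ge0 (w 0 i); have := sqnormc_ge0 (w 0 j).
  have := sqnormc_ge0 ((w - w') 0 i); have := sqnormc_ge0 ((w - w') 0 j).
  have := sqnorm_ge0 (z - z'); have := sqnorm_ge0 Q.
  move: (rest w) (rest (w - w')) (sqnorm (z - z')) (sqnorm Q) => r r' s Qn.
  move: (sqnorm (Q + - u)) => v.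
  move: (sqnormc (w 0 i)) (sqnormc (w 0 j)) => x y.
  move: (sqnormc ((w - w') 0 i)) (sqnormc ((w - w') 0 j)) => x' y'.
  move: (2 ^+ m : R)^-1 => e; move: (2 ^+ m : R) => p Qn0 s0 y'0 x'0 y0 x0 r'0 r0 pe p0.
  have := addr_ge0 (sqnormc_ge0 (z' 0 0 ^+ m)) (sqnormc_ge0 (z' 0 1 ^+ m)).
  move: (sqnormc (z' 0 0 ^+ m) + sqnormc (z' 0 1 ^+ m)) => d d0.
  move: (sqnormc (z 0 0 ^+ m - _) + sqnormc _) => t ed ts vQ dv.
  have k1 : t * (x + y) <= K * s * (x + y) by rewrite ler_wpM2r ?addr_ge0.
  have k2 : p * (e * (x' + y')) <= p * (d * (x' + y')).
    by rewrite !ler_wpM2l // ler_wpM2r ?addr_ge0.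
  have {}k2 : x' + y' <= p * (d * (x' + y')) by rewrite [p * (e * _)]mulrA pe mul1r in k2.
  have k3 : d * (x' + y') <= 2 * Qn + 2 * (K * s * (x + y)) by lra.
  have k6 : r' <= 2 * Qn + 2 * (K * s * (x + y)).
    have : 0 <= d * (x' + y') by rewrite mulr_ge0 ?addr_ge0.
    lra.
  have {k3} k3 : p * (d * (x' + y')) <= p * (2 * Qn + 2 * (K * s * (x + y))).
    by rewrite ler_wpM2l.
  have k4 : 0 <= s * (x + y + r) by rewrite !(mulr_ge0, addr_ge0).
  have k5 : 0 <= K * (s * r) by rewrite !(mulr_ge0, addr_ge0).
  have k7 : 0 <= p * (K * (s * r)) by rewrite !(mulr_ge0, addr_ge0).
  have k8 : 0 <= p * (s * (x + y + r)) by rewrite !(mulr_ge0, addr_ge0).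
  have k9 : 0 <= K * Qn by rewrite mulr_ge0.
  have k10 : 0 <= p * (K * Qn) by rewrite !mulr_ge0.
  lra.
Qed.

(* O(-k)^n has real class kn mod 2 in pi_1(SO(2n)), so it is trivial for k
   even; the coordinates are trivialised one at a time against the zeroth. *)
Lemma trivialization (R : realType) (n m : nat) : (2 <= n)%N ->
  exists T : 'rV[R[i]]_2 -> 'rV[R[i]]_n -> 'rV[R[i]]_n,
    bundle_iso (fun=> - (2 * m)%:Z) (fun=> 0) T.
Proof.
case: n => [|[|n]] // _.
(* The first s coordinates already have weight 0. The induction starts at s = 2, because the first
   move treats a pair. *)
pose wt (s : nat) (j : 'I_n.+2) : int := if (j < s)%N then 0 else - (2 * m)%:Z.
suff iso s : (2 <= s <= n.+2)%N ->
    exists T : 'rV[R[i]]_2 -> 'rV[R[i]]_n.+2 -> 'rV[R[i]]_n.+2,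
      bundle_iso (fun=> - (2 * m)%:Z) (wt s) T.
  have [|T isoT] := iso n.+2; first by rewrite leqnn.
  exists T; congr bundle_iso: isoT; apply/funext => j.
  by rewrite /wt ltn_ord.
elim: s => [//|s IH] /andP[].
rewrite leq_eqVlt => /orP[/eqP [<-] _|s2 sn].
  (* Weights of the pair (0, 1): (-2m, -2m), then (-2m, 2m), then (0, 0). *)
  pose a1 (j : 'I_n.+2) : int := if j == 1 then (2 * m)%:Z else - (2 * m)%:Z.
  have iso1 : bundle_iso (fun=> - (2 * m)%:Z) a1 (fun (_ : 'rV[R[i]]_2) => conj_coord 1).
    apply: bundle_iso_conj => [|l /negPf l1]; rewrite /a1 ?eqxx ?opprK //.
    by rewrite l1.
  have iso2 : bundle_iso a1 (wt 2) (fun (z : 'rV[R[i]]_2) =>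
      quat_coords 0 1 (z 0 0 ^+ (2 * m)) (z 0 1 ^+ (2 * m))).
    apply: bundle_iso_quat => //; rewrite /a1 /wt /=; try lia.
    by move=> [[|[|l]] hl].
  by eexists; exact: (bundle_iso_comp iso1 iso2).
have [|T isoT] := IH; first by rewrite -ltnS s2 ltnW.
have s0 : (0 < s)%N by lia.
pose j : 'I_n.+2 := Ordinal sn.
have j0 : j != 0 by rewrite -val_eqE /= -lt0n.
(* Weights of the pair (j, 0): (-2m, 0), (-m, -m), (-m, m), (0, 0). The half weight -m is where k =
   2m has to be even. *)
pose a1 (l : 'I_n.+2) : int :=
  if (l == j) || (l == 0) then - m%:Z else wt s l.
have iso1 : bundle_iso (wt s) a1 (fun (z : 'rV[R[i]]_2) =>
    quat_coords j 0 (z 0 0 ^+ m) (z 0 1 ^+ m)).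
  have wj : wt s j = - (2 * m)%:Z by rewrite /wt ltnn.
  have w0 : wt s 0 = 0 by rewrite /wt /= s0.
  apply: bundle_iso_quat => //; rewrite ?wj ?w0 /a1 ?eqxx ?orbT /=; try lia.
  by move=> l /negPf -> /negPf ->.
pose a2 (l : 'I_n.+2) : int :=
  if l == j then - m%:Z else if l == 0 then m%:Z else wt s l.
have iso2 : bundle_iso a1 a2 (fun (_ : 'rV[R[i]]_2) => conj_coord 0).
  apply: bundle_iso_conj => [|l /negPf l0]; rewrite /a1 /a2.
    by rewrite eq_sym (negPf j0) eqxx opprK.
  by rewrite l0 orbF.
have iso3 : bundle_iso a2 (wt s.+1) (fun (z : 'rV[R[i]]_2) =>
    quat_coords j 0 (z 0 0 ^+ m) (z 0 1 ^+ m)).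
  apply: bundle_iso_quat => //; rewrite /a2 /wt ?eqxx ?[0 == j]eq_sym ?(negPf j0);
    rewrite /= ?ltnSn; try lia.
  move=> l lj l0; rewrite (negPf lj) (negPf l0) ltnS leq_eqVlt.
  by rewrite (_ : (l == s :> nat) = false) //; apply/negbTE.
by eexists; exact: (bundle_iso_comp (bundle_iso_comp
  (bundle_iso_comp isoT iso1) iso2) iso3).
Qed.

(** * Equivalence of the cones *)

Lemma affine_cone_unit (R : realType) (k n : nat) (x : 'rV[R[i]]_(k.+1 * n)) :
  (0 < n)%N ->
  affine_cone (Xkn R[i] k n) x <->
  exists (z : 'rV[R[i]]_2) (w : 'rV[R[i]]_n),
    sqnorm z = 1 /\ x = scroll_vec k z w.
Proof.
move=> n0; rewrite affine_cone_Xkn //; split=> -[z [w [hz ->]]]; last first.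
  exists z, w; split=> //; apply: contra_eq_neq hz => ->.
  by rewrite sqnorm0 eq_sym oner_eq0.
have sz0 : 0 < sqnorm z.
  rewrite lt_neqAle sqnorm_ge0 andbT eq_sym; apply: contra_neq hz.
  exact: sqnorm_eq0.
have r0 : Num.sqrt (sqnorm z) != 0 by rewrite gt_eqF // sqrtr_gt0.
set r := Num.sqrt _ in r0.
have rC0 : r%:C%C != 0 :> R[i] by rewrite eq_complex /= negb_and r0.
exists ((r%:C%C)^-1 *: z), (r%:C%C ^+ k *: w); split; last first.
  by rewrite scroll_vecZ -exprMn mulVf // expr1n scale1r.
have : sqnormc (r%:C%C : R[i]) * sqnormc ((r%:C%C)^-1 : R[i]) = 1.
  by rewrite -sqnormcM mulfV // sqnormc1.
rewrite sqnormZ {1}/sqnormc /= expr0n addr0 sqr_sqrtr ?sqnorm_ge0 //.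
by rewrite mulrC.
Qed.

(** A relation and not a function, because x determines z only up to a phase. Its symmetry in the
    two cones turns each statement about the map into one about its inverse. *)
Definition scroll_rel (R : realType) (k l n : nat)
    (T U : 'rV[R[i]]_2 -> 'rV[R[i]]_n -> 'rV[R[i]]_n)
    (x : 'rV[R[i]]_(k.+1 * n)) (y : 'rV[R[i]]_(l.+1 * n)) : Prop :=
  exists (z : 'rV[R[i]]_2) (w u : 'rV[R[i]]_n),
    [/\ sqnorm z = 1, x = scroll_vec k z w, y = scroll_vec l z u &
        T z w = U z u].

Lemma scroll_relC (R : realType) (k l n : nat)
    (T U : 'rV[R[i]]_2 -> 'rV[R[i]]_n -> 'rV[R[i]]_n)
    (x : 'rV[R[i]]_(k.+1 * n)) (y : 'rV[R[i]]_(l.+1 * n)) :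
  scroll_rel T U x y -> scroll_rel U T y x.
Proof. by move=> [z [w [u [hz -> -> e]]]]; exists z, u, w. Qed.

Lemma scroll_rel_cone (R : realType) (k l n : nat)
    (T U : 'rV[R[i]]_2 -> 'rV[R[i]]_n -> 'rV[R[i]]_n)
    (x : 'rV[R[i]]_(k.+1 * n)) (y : 'rV[R[i]]_(l.+1 * n)) :
  (0 < n)%N -> scroll_rel T U x y -> affine_cone (Xkn R[i] l n) y.
Proof.
move=> n0 [z [w [u [hz _ -> _]]]]; apply/affine_cone_unit => //.
by exists z, u.
Qed.

Lemma scroll_rel_total (R : realType) (k l n : nat) (a b : 'I_n -> int)
    (T U : 'rV[R[i]]_2 -> 'rV[R[i]]_n -> 'rV[R[i]]_n)
    (x : 'rV[R[i]]_(k.+1 * n)) :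
  (0 < n)%N -> bundle_iso a b U ->
  affine_cone (Xkn R[i] k n) x ->
  exists y : 'rV[R[i]]_(l.+1 * n), scroll_rel T U x y.
Proof.
move=> n0 [[_ surjU _] _] /(affine_cone_unit _ n0)[z [w [hz ->]]].
have [u hu] := surjU z (T z w) hz.
by exists (scroll_vec l z u), z, w, u.
Qed.

Lemma scroll_vec_unit (R : realType) (k n : nat) (c : R[i])
    (z : 'rV[R[i]]_2) (w : 'rV[R[i]]_n) :
  sqnormc c = 1 ->
  scroll_vec k (c *: z) (weighted_scale (fun=> - k%:Z) c w) = scroll_vec k z w.
Proof.
move=> hc; have c0 := unitc_neq0 hc.
have -> : weighted_scale (fun=> - k%:Z) c w = c ^- k *: w.
  by apply/rowP => j; rewrite !mxE -invr_expz.
by rewrite scroll_vecZ mulfV ?expf_neq0 // scale1r.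
Qed.

(** T is Lipschitz forwards and U backwards, so u is controlled by w with the same z, and the two
    cones are compared through the same expression in z and w. *)
Lemma scroll_rel_lipschitz (R : realType) (k l n : nat)
    (T U : 'rV[R[i]]_2 -> 'rV[R[i]]_n -> 'rV[R[i]]_n) :
  (0 < k)%N ->
  bundle_iso (fun=> - k%:Z) (fun=> 0) T ->
  bundle_iso (fun=> - l%:Z) (fun=> 0) U ->
  exists2 K : R, 0 <= K &
    forall (x x' : 'rV[R[i]]_(k.+1 * n)) (y y' : 'rV[R[i]]_(l.+1 * n)),
      scroll_rel T U x y -> scroll_rel T U x' y' ->
      sqnorm (y - y') <= K * sqnorm (x - x').
Proof.
move=> k0 [[_ _ eT] [T0 [K K0 LT] _]] [[_ _ eU] [U0 _ [L L0 IU]]].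
pose C : R := l%:R * (1 + L * K) + L * L * K + L * K + L * K.
have C0 : 0 <= C by rewrite /C !(addr_ge0, mulr_ge0) // ler0n.
(* 6 comes from [bombieri_scroll_ge], 2^k from comparing the weighted norm with the Euclidean one,
   and C from passing from w to u. *)
exists (C * (6 * 2 ^+ k)) => [|x x' y y'].
  by rewrite !mulr_ge0 // exprn_ge0.
move=> [z [w [u [hz -> -> ewu]]]] [z1 [w1 [u1 [hz1 -> -> ewu1]]]].
have [c hc [t t0 ht]] := hermitian_phase z z1.
(* Aligning the phase of z1 changes neither point, and T and U have the same target weights, so the
   relation between w1 and u1 persists. *)
rewrite -(scroll_vec_unit k z1 w1 hc) -(scroll_vec_unit l z1 u1 hc).
have {hz1} hz' : sqnorm (c *: z1) = 1 by rewrite sqnormZ hc hz1 mulr1.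
have := eU z1 u1 c hc; rewrite -ewu1 -eT // => ewu' {ewu1}.
move: (weighted_scale _ _ u1) (weighted_scale _ _ w1) (c *: z1) ht hz' ewu'
  => u' w' z' ht hz' ewu'.
have hx := bombieri_scroll_ge w w' k0 hz hz' t0 ht.
have hx2 := bombieri_le_sqnorm (scroll_vec k z w - scroll_vec k z' w').
have hy := bombieri_scroll_le l u u' hz hz' t0 ht.
have hy2 := sqnorm_le_bombieri (scroll_vec l z u - scroll_vec l z' u').
have Tle v (w0 : 'rV[R[i]]_n) : sqnorm v = 1 ->
    sqnorm (T v w0) <= K * sqnorm w0.
  move=> hv; have := LT v v w0 0 hv hv.
  by rewrite T0 !subr0 subrr sqnorm0 mul0r add0r.
have Uge v (u0 : 'rV[R[i]]_n) : sqnorm v = 1 ->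
    sqnorm u0 <= L * sqnorm (U v u0).
  move=> hv; have := IU v v u0 0 hv hv.
  by rewrite U0 !subr0 subrr sqnorm0 mul0r add0r.
have Su : sqnorm u <= L * (K * sqnorm w).
  by apply: (le_trans (Uge z u hz)); rewrite ler_wpM2l // -ewu Tle.
have Su' : sqnorm u' <= L * (K * sqnorm w').
  by apply: (le_trans (Uge z' u' hz')); rewrite ler_wpM2l // ewu' Tle.
have Du := IU z z' u u' hz hz'.
rewrite -ewu ewu' in Du.
have Dw := LT z z' w w' hz hz'.
apply: (le_trans hy2); apply: (le_trans hy).
apply: le_trans (_ : C * (sqnorm (z - z') * (sqnorm w + sqnorm w') +
  sqnorm (w - w')) <= _); last first.
  rewrite -mulrA ler_wpM2l //; apply: (le_trans hx).
  by rewrite -mulrA ler_wpM2l.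
have ze0 := sqnorm_ge0 (z - z').
have D1 : sqnorm (u - u') <= L * (sqnorm (z - z') * (L * (K * sqnorm w)) +
    K * (sqnorm (z - z') * sqnorm w + sqnorm (w - w'))).
  apply: (le_trans Du); rewrite ler_wpM2l //; apply: lerD => //.
  by rewrite ler_wpM2l.
have D2 : l%:R * sqnorm (z - z') * (sqnorm u + sqnorm u') <=
    l%:R * sqnorm (z - z') * (L * (K * sqnorm w) + L * (K * sqnorm w')).
  by rewrite ler_wpM2l ?mulr_ge0 ?ler0n // lerD.
apply: (le_trans (lerD D2 D1)); rewrite /C.
have := sqnorm_ge0 w; have := sqnorm_ge0 w'; have := sqnorm_ge0 (w - w').
move: ze0; move: (sqnorm (z - z')) (sqnorm w) (sqnorm w') (sqnorm (w - w')).
have := ler0n R l; move: (l%:R : R) => a a0 s S S' D s0 D0 S'0 S0.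
have b1 : 0 <= a * s * S by rewrite !mulr_ge0.
have b2 : 0 <= a * s * S' by rewrite !mulr_ge0.
have b3 : 0 <= a * D by rewrite !mulr_ge0.
have b4 : 0 <= L * K * a * D by rewrite !mulr_ge0.
have b5 : 0 <= L * L * K * s * S' by rewrite !mulr_ge0.
have b6 : 0 <= L * L * K * D by rewrite !mulr_ge0.
have b7 : 0 <= L * K * D by rewrite !mulr_ge0.
have b8 : 0 <= L * K * s * S by rewrite !mulr_ge0.
have b9 : 0 <= L * K * s * S' by rewrite !mulr_ge0.
lra.
Qed.

(** * Semi-algebraicity of the graph *)

Definition complexify (R : realType) (p : nat) (v : 'rV[R]_(p + p)) :
  'rV[R[i]]_p := \row_j (lsubmx v 0 j +i* rsubmx v 0 j)%C.

Lemma realifyK (R : realType) (p : nat) :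
  cancel (@realify R p) (@complexify R p).
Proof.
move=> x; apply/rowP => j; rewrite mxE /realify row_mxKl row_mxKr !mxE.
by case: (x 0 j).
Qed.

Lemma complexifyK (R : realType) (p : nat) :
  cancel (@complexify R p) (@realify R p).
Proof.
move=> v; rewrite -[RHS]hsubmxK /realify; congr row_mx; apply/rowP => j;
  by rewrite !mxE.
Qed.

Lemma cpolyfunv_complexify (R : realType) (N p : nat)
    (phi : 'rV[R]_N -> 'rV[R]_(p + p)) :
  (forall j, polyfun (fun x => phi x 0 j)) ->
  cpolyfunv (fun x => complexify (phi x)).
Proof.
move=> h j; split.
  have [f hf] := h (lshift p j); exists f => x; rewrite -hf.
  by rewrite [X in complex.Re X]mxE /= mxE.
have [f hf] := h (rshift p j); exists f => x; rewrite -hf.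
by rewrite [X in complex.Im X]mxE /= mxE.
Qed.

Lemma semialgebraic_cpoly_eq (R : realType) (N p : nat)
    (f g : 'rV[R]_N -> 'rV[R[i]]_p) :
  cpolyfunv f -> cpolyfunv g -> semialgebraic [set x | f x = g x].
Proof.
move=> pf pg.
have -> : [set x | f x = g x] = [set x | forall j,
    ([set x | complex.Re (f x 0 j) = complex.Re (g x 0 j)] `&`
     [set x | complex.Im (f x 0 j) = complex.Im (g x 0 j)]) x].
  apply/seteqP; split=> x /=; first by move=> ->.
  move=> h; apply/rowP => j; have [] := h j.
  by case: (f x 0 j) (g x 0 j) => [a b] [c d] /= -> ->.
apply: semialgebraic_forall => j; apply: semialgebraicI.
  exact: semialgebraic_eq (pf j).1 (pg j).1.
exact: semialgebraic_eq (pf j).2 (pg j).2.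
Qed.

Lemma cpolyfunv_scroll (R : realType) (N k n : nat)
    (z : 'rV[R]_N -> 'rV[R[i]]_2) (w : 'rV[R]_N -> 'rV[R[i]]_n) :
  cpolyfunv z -> cpolyfunv w -> cpolyfunv (fun x => scroll_vec k (z x) (w x)).
Proof.
move=> pz pw j; case/mxvec_indexP: j => i j.
apply: eq_cpolyfun (cpolyfunM (cpolyfunM (cpolyfunX (k - i) (pz 0))
  (cpolyfunX i (pz 1))) (pw j)) => x.
by rewrite scroll_vecE.
Qed.

Lemma polyfun_sqnorm (R : realType) (N : nat) (z : 'rV[R]_N -> 'rV[R[i]]_2) :
  cpolyfunv z -> polyfun (fun x => sqnorm (z x)).
Proof.
move=> pz.
have psq s : polyfun (fun x => sqnormc (z x 0 s)).
  by apply: polyfunD; apply: polyfunM; apply (pz s).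
have [f hf] := polyfunD (psq 0) (psq 1).
by exists f => x; rewrite -hf sqnorm2E.
Qed.

Lemma semialgebraic_scroll_rel (R : realType) (k l n : nat) (a b c : 'I_n -> int)
    (T U : 'rV[R[i]]_2 -> 'rV[R[i]]_n -> 'rV[R[i]]_n) :
  bundle_iso a c T -> bundle_iso b c U ->
  semialgebraic [set v | exists (x : 'rV[R[i]]_(k.+1 * n))
    (y : 'rV[R[i]]_(l.+1 * n)),
    scroll_rel T U x y /\ row_mx (realify x) (realify y) = v].
Proof.
move=> [[pT _ _] _] [[pU _ _] _].
set p := (k.+1 * n)%N; set q := (l.+1 * n)%N.
(* Real coordinates of (x, y), followed by those of (z, (w, u)); the second block is projected
   away. *)
pose N := ((p + p + (q + q)) + ((2 + 2) + ((n + n) + (n + n))))%N.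
pose X (s : 'rV[R]_N) := complexify (lsubmx (lsubmx s)).
pose Y (s : 'rV[R]_N) := complexify (rsubmx (lsubmx s)).
pose z (s : 'rV[R]_N) := complexify (lsubmx (rsubmx s)).
pose w (s : 'rV[R]_N) := complexify (lsubmx (rsubmx (rsubmx s))).
pose u (s : 'rV[R]_N) := complexify (rsubmx (rsubmx (rsubmx s))).
have pX : cpolyfunv X.
  apply: cpolyfunv_complexify => j.
  have [f hf] := polyfun_coord R (lshift ((2 + 2) + ((n + n) + (n + n))) (lshift (q + q) j)).
  by exists f => s; rewrite -hf !mxE.
have pY : cpolyfunv Y.
  apply: cpolyfunv_complexify => j.
  have [f hf] := polyfun_coord R (lshift ((2 + 2) + ((n + n) + (n + n))) (rshift (p + p) j)).
  by exists f => s; rewrite -hf !mxE.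
have pz : cpolyfunv z.
  apply: cpolyfunv_complexify => j.
  have [f hf] := polyfun_coord R (rshift (p + p + (q + q)) (lshift ((n + n) + (n + n)) j)).
  by exists f => s; rewrite -hf !mxE.
have pw : cpolyfunv w.
  apply: cpolyfunv_complexify => j.
  have [f hf] := polyfun_coord R (rshift (p + p + (q + q)) (rshift (2 + 2) (lshift (n + n) j))).
  by exists f => s; rewrite -hf !mxE.
have pu : cpolyfunv u.
  apply: cpolyfunv_complexify => j.
  have [f hf] := polyfun_coord R (rshift (p + p + (q + q)) (rshift (2 + 2) (rshift (n + n) j))).
  by exists f => s; rewrite -hf !mxE.
have := @semialgebraic_proj R (p + p + (q + q)) ((2 + 2) + ((n + n) + (n + n)))
  ([set s | sqnorm (z s) = 1] `&` ([set s | X s = scroll_vec k (z s) (w s)] `&`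
   ([set s | Y s = scroll_vec l (z s) (u s)] `&`
    [set s | T (z s) (w s) = U (z s) (u s)]))).
have semi : semialgebraic ([set s | sqnorm (z s) = 1] `&`
   ([set s | X s = scroll_vec k (z s) (w s)] `&`
   ([set s | Y s = scroll_vec l (z s) (u s)] `&`
    [set s | T (z s) (w s) = U (z s) (u s)]))).
  apply: semialgebraicI.
    by apply: semialgebraic_eq; [exact: polyfun_sqnorm | exact: polyfun_cst].
  apply: semialgebraicI.
    by apply: semialgebraic_cpoly_eq => //; exact: cpolyfunv_scroll.
  apply: semialgebraicI.
    by apply: semialgebraic_cpoly_eq => //; exact: cpolyfunv_scroll.
  by apply: semialgebraic_cpoly_eq; [exact: pT | exact: pU].
move/(_ semi); congr semialgebraic; apply/seteqP; split=> v /=.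
  move=> [s]; rewrite /X /Y /z /w /u row_mxKl row_mxKr => -[hz [hX [hY hT]]].
  exists (complexify (lsubmx v)), (complexify (rsubmx v)); split.
    by exists (complexify (lsubmx s)), (complexify (lsubmx (rsubmx s))),
      (complexify (rsubmx (rsubmx s))).
  by rewrite !complexifyK hsubmxK.
move=> [x [y [[z0 [w0 [u0 [hz hx hy hT]]]] <-]]].
exists (row_mx (realify z0) (row_mx (realify w0) (realify u0))).
by rewrite /X /Y /z /w /u !(row_mxKl, row_mxKr) !realifyK.
Qed.

(** That the relation is functional in both directions is the Lipschitz estimate at distance 0.
    Hence arbitrary choice functions are mutually inverse on the cones, and the graph of f is the
    whole relation. *)
Lemma scroll_cone_equiv (R : realType) (k l n : nat)
    (T U : 'rV[R[i]]_2 -> 'rV[R[i]]_n -> 'rV[R[i]]_n) :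
  (0 < n)%N -> (0 < k)%N -> (0 < l)%N ->
  bundle_iso (fun=> - k%:Z) (fun=> 0) T ->
  bundle_iso (fun=> - l%:Z) (fun=> 0) U ->
  bilipschitz_semialgebraic_equiv (affine_cone (Xkn R[i] k n))
    (affine_cone (Xkn R[i] l n)).
Proof.
move=> n0 k0 l0 isoT isoU.
have [K K0 lipK] := scroll_rel_lipschitz k0 isoT isoU.
have [L L0 lipL] := scroll_rel_lipschitz l0 isoU isoT.
have uniqY (x : 'rV[R[i]]_(k.+1 * n)) (y y' : 'rV[R[i]]_(l.+1 * n)) :
    scroll_rel T U x y -> scroll_rel T U x y' -> y = y'.
  move=> h h'; have := lipK _ _ _ _ h h'; rewrite subrr sqnorm0 mulr0 => d0.
  apply/eqP; rewrite -subr_eq0; apply/eqP/sqnorm_eq0/eqP.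
  by rewrite eq_le d0 sqnorm_ge0.
have uniqX (y : 'rV[R[i]]_(l.+1 * n)) (x x' : 'rV[R[i]]_(k.+1 * n)) :
    scroll_rel T U x y -> scroll_rel T U x' y -> x = x'.
  move=> /scroll_relC h /scroll_relC h'; have := lipL _ _ _ _ h h'.
  rewrite subrr sqnorm0 mulr0 => d0.
  apply/eqP; rewrite -subr_eq0; apply/eqP/sqnorm_eq0/eqP.
  by rewrite eq_le d0 sqnorm_ge0.
have [f hf] : {f : 'rV[R[i]]_(k.+1 * n) -> 'rV[R[i]]_(l.+1 * n) &
    forall x, affine_cone (Xkn R[i] k n) x -> scroll_rel T U x (f x)}.
  apply: (@choice _ _ (fun x y => affine_cone (Xkn R[i] k n) x ->
    scroll_rel T U x y)) => x.
  have [Ax|nAx] := pselect (affine_cone (Xkn R[i] k n) x); last by exists 0.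
  by have [y hy] := scroll_rel_total l T n0 isoU Ax; exists y.
have [g hg] : {g : 'rV[R[i]]_(l.+1 * n) -> 'rV[R[i]]_(k.+1 * n) &
    forall y, affine_cone (Xkn R[i] l n) y -> scroll_rel T U (g y) y}.
  apply: (@choice _ _ (fun y x => affine_cone (Xkn R[i] l n) y ->
    scroll_rel T U x y)) => y.
  have [Ay|nAy] := pselect (affine_cone (Xkn R[i] l n) y); last by exists 0.
  have [x hx] := scroll_rel_total k U n0 isoT Ay.
  by exists x => _; exact: scroll_relC.
have fB x : affine_cone (Xkn R[i] k n) x -> affine_cone (Xkn R[i] l n) (f x).
  by move/hf; exact: scroll_rel_cone.
have gA y : affine_cone (Xkn R[i] l n) y -> affine_cone (Xkn R[i] k n) (g y).
  by move/hg/scroll_relC; exact: scroll_rel_cone.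
have lip (p q : nat) (M : R) (x x' : 'rV[R[i]]_p) (y y' : 'rV[R[i]]_q) :
    0 <= M -> sqnorm (y - y') <= M * sqnorm (x - x') ->
    cdist y y' <= Num.sqrt M * cdist x x'.
  by move=> M0 h; rewrite !cdistE -sqrtrM // ler_wsqrtr.
exists f, g; split; split=> //.
- by move=> x Ax; apply: uniqX (hg _ (fB _ Ax)) (hf _ Ax).
- by move=> y Ay; apply: uniqY (hf _ (gA _ Ay)) (hg _ Ay).
- by exists (Num.sqrt K) => x x' Ax Ax'; apply: lip => //; apply: lipK; exact: hf.
- exists (Num.sqrt L) => y y' Ay Ay'; apply: lip => //.
  by apply: lipL; apply: scroll_relC; exact: hg.
- have := @semialgebraic_scroll_rel R k l n _ _ _ T U isoT isoU.
  congr semialgebraic; apply/seteqP; split=> v /=.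
    move=> [x [y [xy <-]]].
    have Ax : affine_cone (Xkn R[i] k n) x by apply: scroll_rel_cone (scroll_relC xy).
    by exists x => //; rewrite (uniqY _ _ _ (hf _ Ax) xy).
  by move=> [x Ax <-]; exists x, (f x); split=> //; exact: hf.
Qed.

(** * Dimension and degree *)

Lemma digits_inj (B n : nat) (f g : 'I_n -> nat) :
  (forall i, f i < B)%N -> (forall i, g i < B)%N ->
  (\sum_(i < n) f i * B ^ i = \sum_(i < n) g i * B ^ i)%N -> f =1 g.
Proof.
elim: n f g => [|n IH] f g hf hg; first by move=> _ [].
have B0 : (0 < B)%N by apply: leq_ltn_trans (hf ord0).
have shift (h : 'I_n.+1 -> nat) :
    (\sum_(i < n.+1) h i * B ^ i =
     (\sum_(i < n) h (lift ord0 i) * B ^ i) * B + h ord0)%N.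
  rewrite big_ord_recl expn0 muln1 addnC; congr addn; rewrite big_distrl /=.
  by apply: eq_bigr => i _; rewrite expnSr mulnA.
rewrite !shift => E.
have E0 : f ord0 = g ord0.
  by have := congr1 (modn^~ B) E; rewrite !modnMDl !modn_small.
have {}E := congr1 (divn^~ B) E; rewrite !divnMDl // !divn_small // !addn0 in E.
move=> i; case: (unliftP ord0 i) => [j|] -> //.
by apply: (IH (fun j => f (lift ord0 j)) (fun j => g (lift ord0 j))).
Qed.

Lemma poly_nonroot (F : numFieldType) (p : {poly F}) :
  p != 0 -> exists t, p.[t] != 0.
Proof.
move=> p0; pose s : seq F := [seq i%:R | i <- iota 0 (size p)].
have us : uniq s.
  by rewrite map_inj_uniq ?iota_uniq // => i j /eqP; rewrite eqr_nat => /eqP.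
have /allPn[t _ pt] : ~~ all (root p) s.
  apply/negP => /(max_poly_roots p0)/(_ us).
  by rewrite size_map size_iota ltnn.
by exists t.
Qed.

(* Kronecker substitution X_i := X^(B^i) reduces to one variable. *)
Lemma mpoly_nonroot (F : numFieldType) (n : nat) (p : {mpoly F[n]}) :
  p != 0 -> exists v, p.@[v] != 0.
Proof.
(* [msize p] exceeds every exponent in the support, so distinct monomials have distinct base B codes
   e. *)
move=> p0; pose B := msize p; pose e (m : 'X_{1..n}) := (\sum_(i < n) m i * B ^ i)%N.
pose q : {poly F} := \sum_(m <- msupp p) p@_m *: 'X^(e m).
have eI : {in msupp p &, injective e}.
  move=> m m' mp mp' E; apply/mnmP; apply: digits_inj E => i.
    apply: leq_ltn_trans (msize_mdeg_lt mp).
    by rewrite mdegE (bigD1 i) //= leq_addr.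
  apply: leq_ltn_trans (msize_mdeg_lt mp').
  by rewrite mdegE (bigD1 i) //= leq_addr.
have q0 : q != 0.
  have mp := mlead_supp p0; set m := mlead p in mp.
  apply/eqP => /(congr1 (coefp (e m))); rewrite /= coef0 coef_sum.
  rewrite (bigD1_seq m) //= big1_seq => [|m' /andP[m'm mp']].
    rewrite addr0 coefZ coefXn eqxx mulr1 => /eqP.
    by rewrite mcoeff_eq0 mp.
  rewrite coefZ coefXn (_ : (e m == e m') = false) ?mulr0 //.
  by apply/negbTE; apply: contra m'm => /eqP /eI -> //.
have [t qt] := poly_nonroot q0; exists (fun i => t ^+ (B ^ i)).
apply: contraNneq qt => pt; rewrite /q horner_sum -[X in _ == X]pt mevalE.
apply/eqP; apply: eq_bigr => m _; rewrite hornerZ hornerXn; congr (_ * _).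
rewrite /e -prodrXr; apply: eq_bigr => i _.
by rewrite -exprM mulnC.
Qed.

(** The size of the Sylvester matrix depends on the degrees, which f must therefore preserve. *)
Lemma resultant_map (aR rR : nzRingType) (f : {rmorphism aR -> rR})
    (p q : {poly aR}) :
  f (lead_coef p) != 0 -> f (lead_coef q) != 0 ->
  f (resultant p q) = resultant (map_poly f p) (map_poly f q).
Proof.
move=> fp fq; rewrite /resultant /Sylvester_mx !size_map_poly_id0 //.
rewrite -det_map_mx /= map_col_mx; congr (\det (col_mx _ _));
  by apply: map_lin1_mx => v; rewrite map_poly_rV rmorphM /= map_rVpoly.
Qed.

Lemma coefM_top (R : comNzRingType) (p q : {poly R}) (a b : nat) :
  (size p <= a.+1)%N -> (size q <= b.+1)%N ->
  (size (p * q)%R <= (a + b).+1)%N /\ (p * q)`_(a + b) = p`_a * q`_b.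
Proof.
move=> hp hq; split.
  apply: (leq_trans (size_polyMleq p q)).
  have := leq_add hp hq; rewrite addSn addnS.
  by case: (size p + size q)%N.
have ltab : (a < (a + b).+1)%N by rewrite ltnS leq_addr.
rewrite coefM (bigD1 (Ordinal ltab)) //= addKn big1 ?addr0 // => i ia.
have [lia|lai] := ltnP i a.
  rewrite [q`__]nth_default ?mulr0 //; apply: (leq_trans hq).
  by rewrite ltn_subRL ltn_add2r.
rewrite [p`__]nth_default ?mul0r //; apply: (leq_trans hp).
by rewrite ltn_neqAle lai eq_sym andbT -val_eqE in ia *.
Qed.

Lemma coef_prod_top (R : comNzRingType) (I : Type) (r : seq I) (k : nat)
    (p : I -> {poly R}) :
  (forall i, size (p i) <= k.+1)%N ->
  (size (\prod_(i <- r) p i)%R <= (size r * k).+1)%N /\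
  (\prod_(i <- r) p i)`_(size r * k) = \prod_(i <- r) (p i)`_k.
Proof.
move=> hp; elim: r => [|i r [IH1 IH2]].
  by rewrite !big_nil mul0n coef1 eqxx size_poly1.
rewrite !big_cons /= mulSn -IH2; exact: coefM_top.
Qed.

(** The determinant is treated as having formal degree n k even if its leading terms cancel: the
    coefficient n k is the value at infinity of the corresponding binary form. *)
Lemma coef_det_top (R : comNzRingType) (n k : nat) (A : 'M[{poly R}]_n) :
  (forall i j, size (A i j) <= k.+1)%N ->
  (size (\det A)%R <= (n * k).+1)%N /\
  (\det A)`_(n * k) = \det (map_mx (coefp k) A).
Proof.
move=> hA.
have hs (s : 'S_n) : (size (\prod_i A i (s i))%R <= (n * k).+1)%N /\
    (\prod_i A i (s i))`_(n * k) = \prod_i (A i (s i))`_k.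
  have := coef_prod_top (enum 'I_n) (fun i => hA i (s i)).
  by rewrite size_enum_ord !big_enum.
rewrite /determinant; split.
  apply: (leq_trans (size_sum _ _ _)); apply/bigmax_leqP => s _.
  rewrite -[(-1) ^+ s]/((-1) ^+ s) -signr_odd; case: (odd s).
    by rewrite expr1 mulN1r size_polyN; case: (hs s).
  by rewrite expr0 mul1r; case: (hs s).
rewrite coef_sum; apply: eq_bigr => s _.
rewrite (eq_bigr (fun i => (A i (s i))`_k)) => [|i _]; last by rewrite mxE.
rewrite -(hs s).2 -signr_odd -[in RHS]signr_odd; case: (odd s).
  by rewrite !expr1 !mulN1r coefN.
by rewrite !expr0 !mul1r.
Qed.

(** * Linear sections as determinants of binary forms *)

Definition slice_mx (R : comNzRingType) (k n r : nat)
    (A : 'M[R]_(k.+1 * n, r)) (z : 'rV[R]_2) : 'M[R]_(n, r) :=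
  \matrix_(j, c) \sum_(i < k.+1)
    z 0 0 ^+ (k - i) * z 0 1 ^+ i * A (mxvec_index i j) c.

Definition slice_poly_mx (R : comNzRingType) (k n : nat)
    (A : 'M[R]_(k.+1 * n, n)) : 'M[{poly R}]_n :=
  \matrix_(j, c) \poly_(i < k.+1) A (mxvec_index (inord i) j) c.

Definition slice_det (R : comNzRingType) (k n : nat)
    (A : 'M[R]_(k.+1 * n, n)) : {poly R} := \det (slice_poly_mx A).

Definition affine_pt (R : comNzRingType) (t : R) : 'rV[R]_2 :=
  \row_s (if s == 0 then 1 else t).

Lemma affine_pt_neq0 (R : comNzRingType) (t : R) : affine_pt t != 0.
Proof.
by apply/eqP => /rowP/(_ 0); rewrite !mxE /= => /eqP; rewrite oner_eq0.
Qed.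

Lemma scroll_vec_mul (F : fieldType) (k n r : nat) (A : 'M[F]_(k.+1 * n, r))
    (z : 'rV[F]_2) (w : 'rV[F]_n) :
  scroll_vec k z w *m A = w *m slice_mx A z.
Proof.
apply/rowP => c; rewrite !mxE sum_mxvec exchange_big /=.
apply: eq_bigr => j _; rewrite mxE mulr_sumr; apply: eq_bigr => i _.
by rewrite scroll_vecE; ring.
Qed.

Lemma slice_mx_affine (F : fieldType) (k n : nat) (A : 'M[F]_(k.+1 * n, n))
    (t : F) :
  slice_mx A (affine_pt t) = map_mx (horner_eval t) (slice_poly_mx A).
Proof.
apply/matrixP => j c; rewrite !mxE /= /horner_eval horner_poly.
apply: eq_bigr => i _.
by rewrite expr1n mul1r mulrC inord_val.
Qed.

Lemma slice_mxZ (F : fieldType) (k n r : nat) (A : 'M[F]_(k.+1 * n, r))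
    (c : F) (z : 'rV[F]_2) :
  slice_mx A (c *: z) = c ^+ k *: slice_mx A z.
Proof.
apply/matrixP => j d; rewrite !mxE mulr_sumr; apply: eq_bigr => i _.
have <- : c ^+ (k - i) * c ^+ i = c ^+ k by rewrite -exprD subnK // -ltnS.
by rewrite !exprMn; ring.
Qed.

Lemma slice_mx_infty (F : fieldType) (k n : nat) (A : 'M[F]_(k.+1 * n, n))
    (z : 'rV[F]_2) :
  z 0 0 = 0 ->
  slice_mx A z = z 0 1 ^+ k *: map_mx (coefp k) (slice_poly_mx A).
Proof.
move=> z0; apply/matrixP => j c; rewrite !mxE /= coef_poly ltnSn.
rewrite big_ord_recr /= big1 => [|i _].
  rewrite add0r z0 subnn expr0 mul1r; congr (_ * A _ _).
  by congr mxvec_index; apply: val_inj; rewrite /= inordK.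
by rewrite z0 expr0n subn_eq0 leqNgt ltn_ord !mul0r.
Qed.

Lemma slice_det_top (R : comNzRingType) (k n : nat) (A : 'M[R]_(k.+1 * n, n)) :
  (size (slice_det A) <= (n * k).+1)%N /\
  (slice_det A)`_(n * k) = \det (map_mx (coefp k) (slice_poly_mx A)).
Proof.
by apply: coef_det_top => j c; rewrite mxE; exact: size_poly.
Qed.

Lemma horner_slice_det (F : fieldType) (k n : nat) (A : 'M[F]_(k.+1 * n, n))
    (t : F) :
  (slice_det A).[t] = \det (slice_mx A (affine_pt t)).
Proof. by rewrite slice_mx_affine det_map_mx. Qed.

Lemma linear_subspace_pt (F : fieldType) (N r : nat) (A : 'M[F]_(N, r))
    (v : 'rV[F]_N) (v0 : v != 0) :
  linear_subspace A (proj_pt v0) <-> v *m A = 0.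
Proof.
rewrite /linear_subspace /=; have [c c0 ->] := proj_repP v0.
rewrite -scalemxAl; split=> [/eqP|->]; last by rewrite scaler0.
by rewrite scaler_eq0 (negPf c0) => /eqP.
Qed.

Lemma Xkn_meets (F : closedFieldType) (k n : nat) (A : 'M[F]_(k.+1 * n, n)) :
  (0 < k)%N -> (0 < n)%N -> Xkn F k n `&` linear_subspace A !=set0.
Proof.
move=> k0 n0.
suff [z z0 dz] : exists2 z : 'rV[F]_2, z != 0 & \det (slice_mx A z) = 0.
  have /det0P[w w0 wz] : \det (slice_mx A z) == 0 by rewrite dz.
  exists (proj_pt (scroll_vec_neq0 k z0 w0)); split.
    by apply/XknP; exists z, w, z0, w0.
  by apply/linear_subspace_pt; rewrite scroll_vec_mul.
(* Only a nonzero constant has no root in the affine chart. In that case the coefficient n k > 0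
   vanishes, so (0 : 1) is a root. *)
have [|] := boolP (size (slice_det A) == 1).
  move/eqP => s1.
  exists (\row_s (if s == 0 then 0 else 1)).
    by apply/eqP => /rowP/(_ 1); rewrite !mxE /= => /eqP; rewrite oner_eq0.
  rewrite slice_mx_infty ?mxE // expr1n scale1r -(slice_det_top A).2.
  by rewrite nth_default // s1 muln_gt0 n0.
move=> /closed_rootP[t /rootP rt]; exists (affine_pt t).
  exact: affine_pt_neq0.
by rewrite -horner_slice_det.
Qed.

(** The n + 1 forms are the coefficients of w(X) (z0^k + z1^k X), where w(X) is the polynomial with
    coefficients w; a product of nonzero polynomials is nonzero. *)
Lemma Xkn_missed (F : fieldType) (k n : nat) :
  (0 < k)%N ->
  exists A : 'M[F]_(k.+1 * n, n.+1), Xkn F k n `&` linear_subspace A = set0.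
Proof.
move=> k0.
pose B (i : 'I_k.+1) (j : 'I_n) (r : 'I_n.+1) : F :=
  (i == ord0)%:R * (r == j :> nat)%:R +
  (i == ord_max)%:R * (r == j.+1 :> nat)%:R.
pose A : 'M[F]_(k.+1 * n, n.+1) := \matrix_(l, r)
  (mxvec (\matrix_(i, j) B i j r)) 0 l.
exists A; apply/seteqP; split=> // p [/XknP[z [w [z0 [w0 ->]]]]].
move=> /linear_subspace_pt; rewrite scroll_vec_mul => wA.
have ent j r : slice_mx A z j r =
    z 0 0 ^+ k * (r == j :> nat)%:R + z 0 1 ^+ k * (r == j.+1 :> nat)%:R.
  rewrite mxE (bigD1 ord0) //= (bigD1 ord_max) /=; last first.
    by rewrite -val_eqE /= -lt0n.
  rewrite big1 => [|i /andP[i0 im]].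
    rewrite !mxE !mxvecE !mxE /B !eqxx subnn subn0 !expr0 mul1r mulr1 addr0.
    have -> : (ord_max == ord0 :> 'I_k.+1) = false.
      by apply/negbTE; rewrite -val_eqE /= -lt0n.
    rewrite [ord0 == _]eq_sym (_ : (ord_max == ord0 :> 'I_k.+1) = false).
      by rewrite !mul0r !mul1r addr0 add0r.
    by apply/negbTE; rewrite -val_eqE /= -lt0n.
  by rewrite !mxE mxvecE mxE /B (negPf i0) (negPf im) !mul0r addr0 mulr0.
have /eqP : (rVpoly w) * ((z 0 0 ^+ k)%:P + (z 0 1 ^+ k) *: 'X) = 0.
  apply/polyP => r; rewrite coef0 mulrDr coefD coefMC -scalerAr coefZ coefMX.
  have [rn|nr] := ltnP r n.+1; last first.
    rewrite [_`_r]nth_default; last first.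
      exact: leq_trans (size_poly _ _) (ltnW nr).
    case: r nr => [|r] //= nr; rewrite [_`_r]nth_default ?mulr0 ?mul0r ?addr0 //.
    by apply: leq_trans (size_poly _ _) _.
  have := congr1 (fun M : 'rV_n.+1 => M 0 (Ordinal rn)) wA; rewrite !mxE => wAr.
  rewrite -[RHS]wAr {wAr}.
  under [RHS]eq_bigr do rewrite ent mulrDr.
  rewrite big_split /=; congr (_ + _).
    have [rn'|nr] := ltnP r n.
      rewrite (bigD1 (Ordinal rn')) //= eqxx mulr1 big1 ?addr0 => [|i].
        by rewrite -(coef_rVpoly_ord w (Ordinal rn')).
      by rewrite -val_eqE /= eq_sym => /negPf ->; rewrite !mulr0.
    rewrite nth_default ?mul0r; last exact: leq_trans (size_poly _ _) nr.
    rewrite big1 // => i _; rewrite (_ : (r == i :> nat) = false) ?mulr0 //.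
    by apply/negbTE; rewrite neq_ltn (leq_trans (ltn_ord i) nr) orbT.
  case: r rn => [|r] rn /=; first by rewrite mulr0 big1 // => i _; rewrite !mulr0.
  have rn' : (r < n)%N by [].
  rewrite (bigD1 (Ordinal rn')) //= eqxx mulr1 big1 ?addr0 => [|i].
    by rewrite -(coef_rVpoly_ord w (Ordinal rn')) mulrC.
  by rewrite -val_eqE /= eqSS eq_sym => /negPf ->; rewrite !mulr0.
rewrite mulf_eq0 => /orP[/eqP w00|/eqP E].
  by case/eqP: w0; rewrite -[w]rVpolyK w00 linear0.
have := congr1 (coefp 0) E; have := congr1 (coefp 1) E.
rewrite /= !coefD !coefZ !coefX !coefC /= mulr0 mulr1 add0r addr0.
move=> /eqP; rewrite expf_eq0 k0 /= => /eqP z1.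
move=> /eqP; rewrite expf_eq0 k0 /= => /eqP z00.
by case/eqP: z0; exact: row2_eq0.
Qed.

Lemma has_dim_Xkn (F : closedFieldType) (k n : nat) :
  (0 < k)%N -> (0 < n)%N -> has_dim (Xkn F k n) n.
Proof.
move=> k0 n0; split; first exact: Xkn_missed.
by move=> A; exact: Xkn_meets.
Qed.

Lemma dvdp_det_rows (F : fieldType) (n : nat) (S : 'M[{poly F}]_n)
    (B : {pred 'I_n}) (q : {poly F}) :
  (forall i j, i \in B -> q %| S i j) -> q ^+ #|B| %| \det S.
Proof.
move=> qB; rewrite /determinant.
elim/big_ind: _ => [|u v|s _]; [exact: dvdp0 | exact: dvdp_add |].
rewrite dvdp_mull // -prodr_const big_mkcond /=.
elim/big_ind2: _ => [|p1 p2 p3 p4|i _]; [exact: dvdpp | exact: dvdp_mul |].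
by case: ifP => [/qB|_]; [exact | exact: dvd1p].
Qed.

(** Constant row operations bring the matrix at t into a form with at least two zero rows; these
    rows of the polynomial matrix are then divisible by X - t. *)
Lemma det_double_root (F : fieldType) (n : nat) (S : 'M[{poly F}]_n) (t : F) :
  (\rank (map_mx (horner_eval t) S) + 2 <= n)%N ->
  ('X - t%:P) ^+ 2 %| \det S.
Proof.
set M := map_mx _ S; set r := \rank M => rn.
pose S' := map_mx polyC (invmx (col_ebase M)) *m S.
have uL := col_ebase_unit M.
have S't : map_mx (horner_eval t) S' = pid_mx r *m row_ebase M.
  rewrite map_mxM /= -/M -[X in _ *m X](mulmx_ebase M) -map_mx_comp.
  rewrite (_ : map_mx _ _ = invmx (col_ebase M)).
    by rewrite -!mulmxA mulKmx.
  by apply/matrixP => i j; rewrite mxE /= /horner_eval hornerC.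
have dS' : \det S' = \det (invmx (col_ebase M)) *: \det S.
  by rewrite det_mulmx det_map_mx mul_polyC.
have d0 : \det (invmx (col_ebase M)) != 0.
  by rewrite -unitfE -unitmxE unitmx_inv.
rewrite -(dvdpZr _ _ d0) -dS'.
pose B := [pred i : 'I_n | (r <= i)%N].
have cB : (1 < #|B|)%N.
  have n1 : (n.-1 < n)%N by lia.
  have n2 : (n.-2 < n)%N by lia.
  apply/card_gt1P; exists (Ordinal n1), (Ordinal n2).
  by split; rewrite -?val_eqE ?inE /=; lia.
apply: (dvdp_trans (dvdp_exp2l _ cB)); apply: dvdp_det_rows => i j.
rewrite inE dvdp_XsubCl => ri; apply/eqP.
have := congr1 (fun X : 'M_n => X i j) S't.
rewrite mxE /= /horner_eval => ->.
rewrite mxE big1 // => l _; by rewrite mxE [(i < r)%N]ltnNge ri andbF mul0r.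
Qed.

Lemma slice_kernel (F : fieldType) (k n : nat) (A : 'M[F]_(k.+1 * n, n))
    (t : F) (w w' : 'rV[F]_n) :
  separable_poly (slice_det A) -> w != 0 -> w' != 0 ->
  w *m slice_mx A (affine_pt t) = 0 -> w' *m slice_mx A (affine_pt t) = 0 ->
  exists2 c, c != 0 & w = c *: w'.
Proof.
move=> sepA w0 w'0 kw kw'; set M := slice_mx _ _ in kw kw'.
have rM : (n - \rank M <= 1)%N.
  rewrite leqNgt; apply/negP => h.
  have : ('X - t%:P) ^+ 2 %| slice_det A.
    apply: det_double_root; rewrite -slice_mx_affine -/M.
    by have := rank_leq_row M; lia.
  rewrite expr2 => /(separable_coprime sepA).
  by rewrite coprimepp size_XsubC.
have wk : (w <= kermx M)%MS by apply/sub_kermxP.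
have w'k : (w' <= kermx M)%MS by apply/sub_kermxP.
have kw'M : (kermx M <= w')%MS.
  have := mxrankS w'k; rewrite -(mxrank_leqif_sup w'k) eqn_leq => -> /=.
  by rewrite mxrank_ker rank_rV w'0.
have /sub_rVP[c Ec] := submx_trans wk kw'M.
exists c => //; apply: contra_neq w0 => c0; by rewrite Ec c0 scale0r.
Qed.

Lemma card_Xkn_slice (F : closedFieldType) (k n : nat)
    (A : 'M[F]_(k.+1 * n, n)) :
  (0 < k)%N -> (0 < n)%N -> (slice_det A)`_(n * k) != 0 ->
  separable_poly (slice_det A) ->
  Xkn F k n `&` linear_subspace A #= `I_(n * k).
Proof.
move=> k0 n0 top sepA; set D := slice_det A in top sepA.
have sD : size D = (n * k).+1.
  apply/eqP; rewrite eqn_leq (slice_det_top A).1 ltnNge.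
  by apply: contra top => h; rewrite nth_default.
have [rs Ers] := closed_field_poly_normal D.
have lD : lead_coef D != 0 by rewrite lead_coef_eq0 -size_poly_eq0 sD.
have urs : uniq rs.
  rewrite -separable_prod_XsubC; move: sepA.
  by rewrite Ers !separable_poly.unlock derivZ coprimepZl // coprimepZr.
have srs : size rs = (n * k)%N.
  by have := congr1 (fun p : {poly F} => size p) Ers; rewrite sD size_scale // size_prod_XsubC => -[].
have rootD t : (t \in rs) = (D.[t] == 0).
  by rewrite Ers hornerZ mulf_eq0 (negPf lD) /= -[_ == 0]/(root _ t)
    root_prod_XsubC.
(* W picks a kernel vector at each root. It is nonzero elsewhere too, so that it always defines a
   projective point. *)
have [W hW] : {W : F -> 'rV[F]_n & forall t, W t != 0 /\
    (D.[t] = 0 -> W t *m slice_mx A (affine_pt t) = 0)}.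
  apply: (@choice _ _ (fun t v => v != 0 /\
    (D.[t] = 0 -> v *m slice_mx A (affine_pt t) = 0))) => t.
  have [/eqP|Dt] := eqVneq (D.[t]) 0.
    by rewrite horner_slice_det => /det0P[v v0 hv]; exists v.
  exists (const_mx 1); split=> [|/eqP]; last by rewrite (negPf Dt).
  apply/eqP => /rowP/(_ (Ordinal n0)); rewrite !mxE => /eqP.
  by rewrite oner_eq0.
pose f (i : nat) := proj_pt (scroll_vec_neq0 k (affine_pt_neq0 rs`_i) (hW rs`_i).1).
have <- : f @` `I_(n * k) = Xkn F k n `&` linear_subspace A.
  apply/seteqP; split=> p.
    move=> [i /= ilt <-]; split.
      by apply/XknP; exists (affine_pt rs`_i), (W rs`_i), (affine_pt_neq0 _), (hW rs`_i).1.
    apply/linear_subspace_pt; rewrite scroll_vec_mul; apply: (hW _).2.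
    by apply/eqP; rewrite -rootD mem_nth // srs.
  move=> [/XknP[z [w [z0 [w0 ->]]]] /linear_subspace_pt].
  rewrite scroll_vec_mul => wz.
  have dz : \det (slice_mx A z) = 0 by apply/eqP/det0P; exists w.
  (* The nonzero top coefficient excludes points of the section over (0 : 1). *)
  have z00 : z 0 0 != 0.
    apply: contraNneq top => z00.
    have z01 : z 0 1 != 0.
      by apply: contra_neq z0; exact: row2_eq0.
    move: dz; rewrite slice_mx_infty // detZ -(slice_det_top A).2 => /eqP.
    by rewrite mulf_eq0 !expf_eq0 (negPf z01) !andbF.
  pose t := z 0 1 / z 0 0.
  have zE : z = z 0 0 *: affine_pt t.
    apply/rowP => -[[|[|//]] hs]; rewrite !mxE /=.
      by rewrite mulr1; congr (z _ _); exact: val_inj.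
    by rewrite mulrCA mulfV // mulr1; congr (z _ _); exact: val_inj.
  have kw : w *m slice_mx A (affine_pt t) = 0.
    move: wz; rewrite zE slice_mxZ -scalemxAr => /eqP.
    by rewrite scaler_eq0 expf_eq0 (negPf z00) andbF => /eqP.
  have Dt : D.[t] = 0.
    by rewrite horner_slice_det; apply/eqP/det0P; exists w.
  have [c c0 Ec] := slice_kernel sepA w0 (hW t).1 kw ((hW t).2 Dt).
  have tin : t \in rs by rewrite rootD Dt.
  exists (index t rs); first by rewrite /= -srs index_mem.
  apply/esym; apply: (@proj_pt_eq _ _ _ _ (z 0 0 ^+ k * c)).
    by rewrite mulf_neq0 // expf_neq0.
  by rewrite nth_index // -scroll_vecZ -zE -Ec.
apply: inj_card_eq => i j; rewrite !inE => ilt jlt /(congr1 val) /= E.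
have : scroll_vec k (affine_pt rs`_i) (W rs`_i) \in
    <[scroll_vec k (affine_pt rs`_j) (W rs`_j)]>%VS by rewrite -E memv_line.
case/vlineP => c Ec.
have /rV0Pn[l Wl] := (hW rs`_i).1.
(* The entries 0 and 1 of v_k(1, t), both present as k >= 1, recover t as their ratio, so distinct
   roots give distinct points. *)
have entry (s : nat) : (s <= 1)%N ->
    rs`_i ^+ s * W rs`_i 0 l = c * (rs`_j ^+ s * W rs`_j 0 l).
  move=> s1; have sk : (s < k.+1)%N by rewrite ltnS (leq_trans s1).
  have := congr1 (fun v : 'rV_(k.+1 * n) => v 0 (mxvec_index (Ordinal sk) l)) Ec.
  by rewrite mxE !scroll_vecE !mxE /= !expr1n !mul1r.
have /eqP := entry 1%N isT; rewrite !expr1.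
have := entry 0%N isT; rewrite !expr0 !mul1r => E0.
rewrite mulrCA -E0 -subr_eq0 -mulrBl mulf_eq0 (negPf Wl) orbF subr_eq0.
by rewrite nth_uniq ?srs // => /eqP.
Qed.

(** * Separability for a generic section *)

Lemma slice_det_map (R S : comNzRingType) (f : {rmorphism R -> S}) (k n : nat)
    (A : 'M[R]_(k.+1 * n, n)) :
  map_poly f (slice_det A) = slice_det (map_mx f A).
Proof.
rewrite /slice_det -det_map_mx; congr (\det _); apply/matrixP => j c.
by apply/polyP => i; rewrite !mxE coef_map /= !coef_poly; case: ifP;
  rewrite ?mxE ?rmorph0.
Qed.

(** In characteristic 0 the derivative has top coefficient m p_m, nonzero along with p_m, so neither
    degree drops under f. *)
Lemma resultant_deriv_map (aR : comNzRingType) (F : numFieldType)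
    (f : {rmorphism aR -> F}) (p : {poly aR}) (m : nat) :
  (0 < m)%N -> (size p <= m.+1)%N -> f p`_m != 0 ->
  f (resultant p p^`()) = resultant (map_poly f p) (map_poly f p)^`().
Proof.
move=> m0 sp fm.
have spE : size p = m.+1.
  apply/eqP; rewrite eqn_leq sp ltnNge; apply: contra fm => h.
  by rewrite nth_default // rmorph0.
have fd : f (p^`())`_m.-1 != 0.
  by rewrite coef_deriv prednK // rmorphMn mulrn_eq0 negb_or -lt0n m0.
have sd : size p^`() = m.
  apply/eqP; rewrite eqn_leq; apply/andP; split.
    by rewrite -ltnS -spE lt_size_deriv // -size_poly_eq0 spE.
  rewrite -(prednK m0) ltnNge; apply: contra fd => h.
  by rewrite nth_default // rmorph0.
by rewrite resultant_map ?deriv_map // lead_coefE ?spE ?sd.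
Qed.

Lemma resultant_separable (F : fieldType) (p : {poly F}) :
  p != 0 -> (resultant p p^`() != 0) = separable_poly p.
Proof.
move=> p0; rewrite resultant_eq0 separable_poly.unlock /coprimep.
have : gcdp p p^`() != 0 by rewrite gcdp_eq0 negb_and p0.
by rewrite -size_poly_eq0; case: (size _) => [|[|]].
Qed.

(** Shows that the generic condition is not void: A is chosen so that the matrix of forms is
    diagonal, with n entries of degree k whose n k roots are the distinct numbers 0, ..., n k -
    1. *)
Lemma exists_separable_slice (F : numFieldType) (k n : nat) :
  exists A : 'M[F]_(k.+1 * n, n),
    (slice_det A)`_(n * k) != 0 /\ separable_poly (slice_det A).
Proof.
pose a (p : 'I_n * 'I_k) : F := (enum_rank p)%:R.
pose q (c : 'I_n) : {poly F} := \prod_(i < k) ('X - (a (c, i))%:P).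
pose A : 'M[F]_(k.+1 * n, n) := \matrix_(l, c)
  (mxvec (\matrix_(i < k.+1, j < n) (if j == c then (q c)`_i else 0))) 0 l.
have sq c : size (q c) = k.+1.
  rewrite /q -big_enum -(big_map (fun i => a (c, i)) xpredT
    (fun x => 'X - x%:P)).
  by rewrite size_prod_XsubC size_map size_enum_ord.
have SA : slice_poly_mx A = diag_mx (\row_c q c).
  apply/matrixP => j c; apply/polyP => i; rewrite !mxE coef_poly.
  case: ifP => ik; last first.
    case: eqP => [->|_]; last by rewrite mulr0n coef0.
    by rewrite mulr1n nth_default // sq leqNgt ik.
  rewrite !mxE mxvecE mxE inordK //.
  by case: eqP => [->|_]; rewrite ?mulr1n // mulr0n coef0.
pose rs := [seq a p | p <- enum {: 'I_n * 'I_k}].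
have DA : slice_det A = \prod_(x <- rs) ('X - x%:P).
  rewrite /slice_det SA det_diag /rs big_map big_enum.
  rewrite (eq_bigr q) => [|c _]; last by rewrite mxE.
  by rewrite /q pair_bigA; apply: eq_bigr => -[].
have srs : size rs = (n * k)%N.
  by rewrite size_map -cardE card_prod !card_ord.
exists A; rewrite DA separable_prod_XsubC; split.
  have /monicP := monic_prod_XsubC rs xpredT id.
  rewrite lead_coefE size_prod_XsubC srs /= => ->; exact: oner_neq0.
rewrite map_inj_uniq ?enum_uniq // => p p' /eqP.
by rewrite eqr_nat => /eqP /ord_inj /enum_rank_inj.
Qed.

Lemma has_degree_Xkn (F : numClosedFieldType) (k n : nat) :
  (0 < k)%N -> (0 < n)%N -> has_degree (Xkn F k n) (n * k).
Proof.
move=> k0 n0; exists n; first exact: has_dim_Xkn.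
(* The generic matrix, with indeterminate entries; every A is a specialisation of it. *)
pose U : 'M[{mpoly F[k.+1 * n * n]}]_(k.+1 * n, n) :=
  \matrix_(l, c) 'X_(mxvec_index l c).
pose D := slice_det U.
have evU (A : 'M[F]_(k.+1 * n, n)) :
    map_poly (meval (fun i => mxvec A 0 i)) D = slice_det A.
  rewrite slice_det_map; congr slice_det; apply/matrixP => l c.
  by rewrite !mxE /= mevalXU mxvecE.
have topE (A : 'M[F]_(k.+1 * n, n)) :
    (D`_(n * k)).@[fun i => mxvec A 0 i] = (slice_det A)`_(n * k).
  by rewrite -evU coef_map.
have evr (A : 'M[F]_(k.+1 * n, n)) : (slice_det A)`_(n * k) != 0 ->
    (D`_(n * k) * resultant D D^`()).@[fun i => mxvec A 0 i] =
    (slice_det A)`_(n * k) * resultant (slice_det A) (slice_det A)^`().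
  move=> top; rewrite mevalM topE -!evU; congr (_ * _).
  apply: (resultant_deriv_map (m := (n * k)%N)).
  - by rewrite muln_gt0 n0.
  - exact: (slice_det_top U).1.
  - by rewrite /= topE.
have nz (A : 'M[F]_(k.+1 * n, n)) :
    (slice_det A)`_(n * k) != 0 -> slice_det A != 0.
  by apply: contraNneq => ->; rewrite coef0.
exists (D`_(n * k) * resultant D D^`()).
  have [A [top sepA]] := exists_separable_slice F k n.
  apply/eqP => /(congr1 (meval (fun i => mxvec A 0 i))); rewrite evr // meval0.
  have := sepA; rewrite -resultant_separable ?nz // => /negPf res.
  by move/eqP; rewrite mulf_eq0 (negPf top) res.
move=> A gA; have top : (slice_det A)`_(n * k) != 0.
  apply: contraNneq gA => top; rewrite mevalM.
  by rewrite topE top mul0r.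
apply: card_Xkn_slice => //.
by move: gA; rewrite evr // mulf_eq0 negb_or top resultant_separable // nz.
Qed.

(** * Uniqueness of dimension and degree *)

Lemma has_dim_unique (F : fieldType) (N : nat) (X : set (proj F N)) (m m' : nat) :
  has_dim X m -> has_dim X m' -> m = m'.
Proof.
suff lt (a b : nat) : (a < b)%N -> has_dim X a -> ~ has_dim X b.
  move=> hm hm'; case: (ltngtP m m') => // h.
    by case: (lt _ _ h hm hm').
  by case: (lt _ _ h hm' hm).
(* Padding the a + 1 forms without common zero on X by zero columns gives b forms that still miss
   X. *)
move=> ab [[A XA] _] [_ /(_ (A *m pid_mx a.+1))[p [Xp]]].
rewrite /linear_subspace /= => pA.
have : (X `&` linear_subspace A) p.
  split=> //; rewrite /linear_subspace /=.
  have -> : proj_rep p *m A =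
      proj_rep p *m (A *m pid_mx a.+1) *m (pid_mx a.+1 : 'M_(b, a.+1)).
    by rewrite -!mulmxA pid_mx_id // pid_mx_1 mulmx1.
  by rewrite pA mul0mx.
by rewrite XA.
Qed.

(** Two nonempty basic open sets of matrices meet, since a nonzero product of polynomials is nonzero
    at some matrix; there both numbers count the same points. *)
Lemma has_degree_unique (F : numFieldType) (N : nat) (X : set (proj F N))
    (d e : nat) :
  has_degree X d -> has_degree X e -> d = e.
Proof.
move=> [m hm [g g0 hg]] [m' hm']; rewrite -(has_dim_unique hm hm').
move=> [g' g'0 hg'].
have /mpoly_nonroot[v] : g * g' != 0 by rewrite mulf_neq0.
pose A : 'M[F]_(N, m) := vec_mx (\row_i v i).
rewrite -(meval_eq (v1 := fun i => mxvec A 0 i)) => [|i]; last first.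
  by rewrite vec_mxK mxE.
rewrite mevalM mulf_eq0 negb_or => /andP[/hg Xd /hg' Xe].
by apply/card_eq_II; exact: card_eq_trans (card_esym Xd) Xe.
Qed.

Theorem theorem3p1 (R : realType) (n : nat) (hn : (2 <= n)%N) :
  ((forall k : nat, (1 <= k)%N ->
      exists d : nat, has_degree (Xkn R[i] k n) d) /\
   (forall k l d e : nat, (1 <= k)%N -> (1 <= l)%N -> k <> l ->
      has_degree (Xkn R[i] k n) d -> has_degree (Xkn R[i] l n) e ->
      d <> e)) /\
  (exists S : set nat,
     [/\ infinite_set S,
         (forall k : nat, S k -> (1 <= k)%N) &
         (forall k l : nat, S k -> S l ->
            bilipschitz_semialgebraic_equiv
              (affine_cone (Xkn R[i] k n)) (affine_cone (Xkn R[i] l n)))]).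
Proof.
have n0 : (0 < n)%N by exact: ltnW.
have degX k : (1 <= k)%N -> has_degree (Xkn R[i] k n) (n * k).
  by move=> k0; exact: has_degree_Xkn.
split; first split.
- by move=> k k1; exists (n * k)%N; exact: degX.
- move=> k l d e k1 l1 kl hd he.
  rewrite (has_degree_unique hd (degX k k1)) (has_degree_unique he (degX l l1)).
  by move=> /eqP; rewrite eqn_pmul2l // => /eqP.
(* The positive even degrees; the successor leaves out k = 0. *)
exists (range (fun m => (2 * m.+1)%N)); split.
- rewrite (eq_finite_set (inj_card_eq _)); first exact: infinite_nat.
  by move=> i j _ _ /eqP; rewrite eqn_pmul2l // => /eqP[].
- by move=> _ [m _ <-].
move=> _ _ [i _ <-] [j _ <-].
have [T isoT] := trivialization R i.+1 hn.
have [U isoU] := trivialization R j.+1 hn.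
exact: scroll_cone_equiv isoT isoU.
Qed.
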